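(* Let $f:\mathbb{R}^d\to\mathbb{R}$ be differentiable with $f_\star:=\inf_{\boldsymbol{x}\in\mathbb{R}^d}f(\boldsymbol{x})>-\infty$, and suppose there is $\boldsymbol{L}\in\mathbb{R}_{>0}^d$ such that $|f(\boldsymbol{x})-f(\boldsymbol{y})-\langle\nabla f(\boldsymbol{y}),\boldsymbol{x}-\boldsymbol{y}\rangle|\le\frac12\|\boldsymbol{x}-\boldsymbol{y}\|_{\boldsymbol{L}}^2$ for all $\boldsymbol{x},\boldsymbol{y}\in\mathbb{R}^d$. Suppose the stochastic gradients $\boldsymbol{g}_t$ satisfy $\mathbb{E}_{t-1}[\boldsymbol{g}_t]=\nabla f(\boldsymbol{x}_t)$ and, for some $p\in(1,2]$ and $\boldsymbol{\sigma}\in\mathbb{R}_{\ge0}^d$, $\mathbb{E}_{t-1}[|\boldsymbol{\xi}_{t,i}|^p]\le\boldsymbol{\sigma}_i^p$ for all $i\in\{1,\dots,d\}$ and all $t$, where $\boldsymbol{\xi}_{t,i}:=\boldsymbol{g}_{t,i}-\nabla_i f(\boldsymbol{x}_t)$. Let $\Delta:=f(\boldsymbol{x}_1)-f_\star$. Then for any $\gamma>0$, $\lambda>0$ and $T\in\mathbb{N}$, the iterates of AdaGrad satisfy $$\mathbb{E}\left[\frac1T\sum_{t=1}^T\|\nabla f(\boldsymbol{x}_t)\|_1\right]\le \mathcal{O}\left(\frac{A}{\sqrt T}+\frac{C\|\boldsymbol{\sigma}\|_1}{T^{\frac{p-1}{p}}}+\frac{\sqrt{B\|\boldsymbol{\sigma}\|_1}}{T^{\frac{p-1}{2p}}}+\frac{\sqrt{C}\,\|\boldsymbol{\sigma}\|_1}{T^{\frac{3p-4}{4p}}}\right),$$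 where $A:=d\lambda+\frac{\Delta}{\gamma}+\gamma\|\boldsymbol{L}\|_1\ln K_T$, $B:=\frac{\Delta}{\gamma}+\gamma\|\boldsymbol{L}\|_1\ln K_T$, $C:=(\ln K_T)^{\frac1{\bar p}+\frac12}$ and $$K_T:=1+\frac{\sqrt2\|\boldsymbol{\sigma}\|_\infty T^{\frac1p}+2\|\nabla f(\boldsymbol{x}_1)\|_\infty T^{\frac12}+2\gamma\sqrt{\|\boldsymbol{L}\|_1\|\boldsymbol{L}\|_\infty}\,T^{\frac32}}{\lambda}.$$
   Context: $\mathbb{N}$ excludes $0$. For $p>1$, $\bar p:=p/(p-1)$ is the conjugate exponent. For $\boldsymbol{L}\in\mathbb{R}_{>0}^d$, $\|\boldsymbol{x}\|_{\boldsymbol{L}}^2:=\sum_{i=1}^d\boldsymbol{L}_i\boldsymbol{x}_i^2$. $\nabla_i f$ is the $i$-th partial derivative. $\mathcal{O}(\cdot)$ hides a universal numerical constant. AdaGrad: given a (deterministic) initial point $\boldsymbol{x}_1\in\mathbb{R}^d$, learning rate $\gamma>0$ and hyperparameter $\lambda>0$, set $\boldsymbol{v}_0=\boldsymbol{0}$ and for $t=1,2,\dots$ query a random stochastic gradient $\boldsymbol{g}_t\in\mathbb{R}^d$ at $\boldsymbol{x}_t$ and set, coordinate-wise for each $i$, $\boldsymbol{v}_{t,i}=\boldsymbol{v}_{t-1,i}+\boldsymbol{g}_{t,i}^2$ and $\boldsymbol{x}_{t+1,i}=\boldsymbol{x}_{t,i}-\frac{\gamma}{\lambda+\sqrt{\boldsymbol{v}_{t,i}}}\boldsymbol{g}_{t,i}$.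 $\mathcal{F}_t:=\sigma(\boldsymbol{g}_1,\dots,\boldsymbol{g}_t)$ is the natural filtration ($\mathcal{F}_0$ trivial) and $\mathbb{E}_t[\cdot]:=\mathbb{E}[\cdot\mid\mathcal{F}_t]$. *)

(* Defs.v *)
From HB Require Import structures.
From mathcomp Require Export all_boot all_order all_algebra.
From mathcomp Require Export all_classical all_reals all_analysis.
Export Order.TTheory GRing.Theory Num.Theory.
Export numFieldNormedType.Exports.

Set Implicit Arguments.
Unset Strict Implicit.
Unset Printing Implicit Defensive.

Local Open Scope classical_set_scope.
Local Open Scope ring_scope.

(* On 'rV[R]_d the norm `|x| of MathComp-Analysis is the sup norm
   max_i |x_i|; it is used as such for ||.||_oo. *)

Definition l1norm (R : realType) (d : nat) (x : 'rV[R]_d) : R :=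
  \sum_(i < d) `|x 0 i|.

Definition wnorm2 (R : realType) (d : nat) (L x : 'rV[R]_d) : R :=
  \sum_(i < d) L 0 i * x 0 i ^+ 2.

Definition dotv (R : realType) (d : nat) (x y : 'rV[R]_d) : R :=
  \sum_(i < d) x 0 i * y 0 i.

Definition gradient (R : realType) (d : nat) (f : 'rV[R]_d -> R)
    (x : 'rV[R]_d) : 'rV[R]_d :=
  \row_(i < d) 'D_('e_i) f x.

(* Time starts at t = 1: the values g 0 and x 0 are irrelevant. *)
Definition is_adagrad (R : realType) (d : nat) (gamma lambda : R)
    (x1 : 'rV[R]_d) (g v x : nat -> 'rV[R]_d) : Prop :=
  [/\ v 0%N = 0, x 1%N = x1 &
      forall t (i : 'I_d), (1 <= t)%N ->
        v t 0 i = v t.-1 0 i + g t 0 i ^+ 2 /\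
        x t.+1 0 i =
          x t 0 i - gamma / (lambda + Num.sqrt (v t 0 i)) * g t 0 i].

(* F_t = sigma(g_1, ..., g_t); F_0 is the trivial sigma-algebra. *)
Definition natural_filtration (R : realType) (d : nat) (Omega : Type)
    (g : nat -> 'I_d -> Omega -> R) (t : nat) : set (set Omega) :=
  <<s \bigcup_(s in [set s | (1 <= s <= t)%N]) \bigcup_i
        preimage_set_system setT (g s i) measurable >>.

(* Y is a version of E[X | G], where G is a sub-sigma-algebra, given by its
   measurable sets. *)
Definition is_cond_expectation (disp : measure_display)
    (Omega : measurableType disp) (R : realType) (P : probability Omega R)
    (G : set (set Omega)) (X Y : Omega -> R) : Prop :=
  [/\ P.-integrable setT (EFin \o X),
      P.-integrable setT (EFin \o Y),
      (forall B : set R, measurable B -> G (Y @^-1` B)) &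
      forall A : set Omega, G A ->
        (\int[P]_(w in A) (Y w)%:E = \int[P]_(w in A) (X w)%:E)%E].

(* E[X | G] <= a almost surely *)
Definition cond_expectation_le (disp : measure_display)
    (Omega : measurableType disp) (R : realType) (P : probability Omega R)
    (G : set (set Omega)) (X : Omega -> R) (a : R) : Prop :=
  exists2 Y : Omega -> R,
    is_cond_expectation P G X Y & {ae P, forall w, Y w <= a}.

(* Main.v *)
From HB Require Import structures.
Require Import Defs.
From mathcomp Require Import all_boot all_order all_algebra.
From mathcomp Require Import all_classical all_reals all_analysis.
From mathcomp Require Import measurable_realfun ring lra.
Import Order.TTheory GRing.Theory Num.Theory.
Import numFieldNormedType.Exports.

Local Open Scope classical_set_scope.
Local Open Scope ring_scope.

(** Fix a coordinate and write [G t] for the partial derivative of [f] at the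
    [t]-th iterate, [g t] for its stochastic estimate, [xi t = g t - G t], and
    [b t] for the denominator [lambda + sqrt (v t)]. The smoothness inequality
    along the trajectory telescopes and bounds the total mean progress, the sum
    of the means of [G t * g t / b t], by [Delta / gamma] plus second-order
    terms [(g t / b t) ^+ 2]. The latter telescope through the logarithm
    ([log_increment_sum]); since each step moves a coordinate by at most
    [gamma], the gradients are bounded along the trajectory, and the mean of
    the final denominator is at most [lambda * K] ([mean_sum_psi_sqr]).

    The difficulty is that [b t] depends on [g t], so that [G t * g t / b t]
    does not have conditional mean [G t ^+ 2 / b t], while the noise only has a
    [p]-th moment. Progress is compared with [G t ^+ 2 / bh t], where [bh t] is
    [b t.-1] plus the Euclidean norm of [G 1, ..., G t], a quantity known before
    [g t] is drawn. Let [Y] be the conditional second moment of the normalised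
    step [psi = |g t| / b t] and let [h = sigma * m `^ (1 - 1/p)], where [m] is
    [Y] up to a small constant; Young's inequality shows that [h] bounds the
    conditional mean of [|xi| * psi] ([noise_correlation]). Three regimes
    ([step_regimes], [one_step]):
    - if [Y] is not small, the step is of substantial length on average, and it points in
      the wrong direction only when the noise exceeds the gradient;
    - if [Y] is small and [|G t|] dominates [h], then [b t] is close to [b t.-1]
      and the linearisation [G t ^+ 2 / b t.-1] survives;
    - if [|G t|] is at most a multiple of [h], everything is an error term.
    In all of them the error is a multiple of [h * (|G t| / bh t + sqrt m)],
    hence of [sigma] times the power [3/2 - 1/p] of [(G t / bh t) ^+ 2 + m].
    Both summands have a sum over time of order [ln K]: the first one because
    [bh t] contains the past gradients, the second one because its mean is that
    of [psi ^+ 2]. As the exponent is at most [1], concavity gives a total error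
    of order [sigma * T `^ (1/p - 1/2) * ln K `^ (3/2 - 1/p)] ([mean_D_le]).

    With [D] the sum of the [G t ^+ 2 / bh t], [S] the Euclidean norm of the
    gradients and [N] that of the noise, [S ^+ 2 <= D * (lambda + 3 * S + 2 * N)].
    Hence [S] is at most of order [D + lambda + s * D + N / s] for every [s > 0],
    and the mean of [N] is at most [sigma * T `^ (1/p)] ([mean_noise]). Summing
    over the coordinates with a common [s], optimising [s], and using that the
    l^1 norm is at most [sqrt T] times the Euclidean one gives the four terms of
    the rate. *)

Set Implicit Arguments.
Unset Strict Implicit.

(** * Real inequalities *)

Section RealInequalities.
Variable R : realType.
Implicit Types (a b l s x y v g : R).

Lemma sqrtrD_le a b : 0 <= a -> 0 <= b ->
  Num.sqrt (a + b) <= Num.sqrt a + Num.sqrt b.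
Proof.
move=> a0 b0; rewrite -(@ler_pXn2r R 2) ?nnegrE ?addr_ge0 ?sqrtr_ge0//.
rewrite sqrrD !sqr_sqrtr ?addr_ge0// -addrA lerD2l -[leLHS]add0r lerD2r.
by rewrite mulrn_wge0// mulr_ge0 ?sqrtr_ge0.
Qed.

Lemma subV_le_ln x : 0 < x -> 1 - x^-1 <= ln x.
Proof.
move=> x0; have := @le_ln1Dx R (x^-1 - 1).
rewrite subrKC lnV ?posrE// => H.
rewrite -lerN2; apply: (le_trans (H _)); last by rewrite opprB.
by rewrite ltrBrDr addNr invr_gt0.
Qed.

Lemma ln_le_tangent k y : 0 < k -> 0 < y -> ln y <= ln k + (y - k) / k.
Proof.
move=> k0 y0; have yk : 0 < y / k by rewrite divr_gt0.
have := @le_ln1Dx R (y / k - 1); rewrite subrKC ltrBrDr addNr => /(_ yk).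
by rewrite ln_div ?posrE// mulrBl divff ?gt_eqF// lerBlDl.
Qed.

(** Concave powers lie below their tangents: Jensen's inequality for them will
    be used in this linear form, which integrates without any further argument. *)
Lemma powR_le_tangent a s x : 0 < a <= 1 -> 0 < s -> 0 <= x ->
  x `^ a <= s `^ a * (1 - a + a * (x / s)).
Proof.
move=> /andP[a0 a1] s0 x0.
have sa : 0 < s `^ a by rewrite powR_gt0.
rewrite -ler_pdivrMl// mulrC.
have -> : x `^ a / s `^ a = (x / s) `^ a.
  rewrite powRM// ?invr_ge0 ?(ltW s0)//; congr (_ * _).
  by rewrite -powRN -[s^-1]powR_inv1 ?(ltW s0)// -powRrM mulN1r.
have z0 : 0 <= x / s by rewrite divr_ge0// ltW.
move: (x / s) z0 => z z0.
move: a1; rewrite le_eqVlt => /predU1P[->|a1].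
  by rewrite powRr1// subrr add0r mul1r.
have := @conjugate_powR R (z `^ a) 1 (a^-1) ((1 - a)^-1).
rewrite powR_ge0 ler01 !invr_gt0 a0 subr_gt0 a1 !invrK mulr1 powR1 mul1r.
rewrite -powRrM mulfV ?gt_eqF// powRr1// => /(_ isT isT isT isT).
rewrite addrC subrK => /(_ erefl); lra.
Qed.

(** The variance-like increments of an AdaGrad denominator telescope through
    the logarithm, because [1 - 1/x <= ln x] at the ratio of two successive
    denominators. *)
Lemma log_increment l v g : 0 < l -> 0 <= v ->
  g ^+ 2 / (l + Num.sqrt (v + g ^+ 2)) ^+ 2 <=
  2 * (ln (l + Num.sqrt (v + g ^+ 2)) - ln (l + Num.sqrt v)).
Proof.
move=> l0 v0; set c := Num.sqrt (v + _); set b := Num.sqrt v.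
have b0 : 0 <= b by exact: sqrtr_ge0.
have c0 : 0 <= c by exact: sqrtr_ge0.
have bc : b <= c by rewrite ler_sqrt ?addr_ge0 ?sqr_ge0// lerDl sqr_ge0.
have -> : g ^+ 2 = c ^+ 2 - b ^+ 2.
  by rewrite !sqr_sqrtr ?addr_ge0 ?sqr_ge0//; ring.
have lb0 : 0 < l + b by lra.
have lc0 : 0 < l + c by lra.
have := @subV_le_ln ((l + c) / (l + b)); rewrite divr_gt0// => /(_ isT).
rewrite ln_div ?posrE// invf_div => H.
apply: le_trans (ler_wpM2l _ H); last by [].
have -> : 1 - (l + b) / (l + c) = (c - b) / (l + c).
  by field; rewrite gt_eqF.
rewrite ler_pdivrMr ?exprn_gt0//.
have -> : 2 * ((c - b) / (l + c)) * (l + c) ^+ 2 = 2 * (c - b) * (l + c).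
  by field; rewrite gt_eqF.
nra.
Qed.

Lemma log_increment_sum l (u : nat -> R) (T : nat) : 0 < l ->
  \sum_(1 <= t < T.+1)
    u t ^+ 2 / (l + Num.sqrt (\sum_(1 <= s < t.+1) u s ^+ 2)) ^+ 2 <=
  2 * (ln (l + Num.sqrt (\sum_(1 <= s < T.+1) u s ^+ 2)) - ln l).
Proof.
move=> l0; elim: T => [|T IH].
  by rewrite !big_geq// sqrtr0 addr0 subrr mulr0.
rewrite big_nat_recr//= (big_nat_recr _ _ (fun k : nat => u k ^+ 2))//=.
have := @log_increment l (\sum_(1 <= s < T.+1) u s ^+ 2) (u T.+1) l0.
rewrite sumr_ge0 => [/(_ isT)|i _]; last exact: sqr_ge0.
move: IH; lra.
Qed.

(** Young's inequality, with weights chosen so that both terms have conditional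
    expectation at most a multiple of [s * m `^ (1 - 1/p)] once the p-th moment
    of [x] is at most [s `^ p] and the mean of [y ^+ 2] is at most [m]. *)
Lemma young_weighted p s m x y : 1 < p <= 2 -> 0 < s -> 0 < m ->
    0 <= x -> 0 <= y <= 1 ->
  x * y <= p^-1 * (s `^ (1 - p) * m `^ (1 - p^-1)) * x `^ p
           + (1 - p^-1) * (s * m `^ (- p^-1)) * y ^+ 2.
Proof.
move=> /andP[p1 p2] s0 m0 x0 /andP[y0 y1].
have p0 : 0 < p by lra.
have pV : p^-1 < 1 by rewrite invf_lt1.
set q := 1 - p^-1.
have q0 : 0 < q by rewrite subr_gt0.
have q2 : 2 <= q^-1.
  rewrite -[2]invrK lef_pV2 ?posrE ?invr_gt0// /q.
  have : 2^-1 <= p^-1 by rewrite lef_pV2 ?posrE//.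
  lra.
have pn : p != 0 by rewrite gt_eqF.
have qn : q != 0 by rewrite gt_eqF.
(* The factor that splits [s * m `^ q] evenly between the two terms. *)
set c := s `^ (- q) * m `^ (q * p^-1).
have c0 : 0 < c by rewrite mulr_gt0// powR_gt0.
have -> : x * y = (x * c) * (y / c).
  by field; rewrite gt_eqF.
apply: le_trans (@conjugate_powR R _ _ p q^-1 _ _ _ _ _) _ => //.
- by rewrite mulr_ge0// ltW.
- by rewrite divr_ge0// ltW.
- by rewrite invr_gt0.
- by rewrite invrK /q addrC subrK.
have cV : c^-1 = s `^ q * m `^ (- (q * p^-1)).
  rewrite /c invfM -!powRN opprK//.
rewrite cV /c !powRM ?mulr_ge0 ?powR_ge0// -!powRrM.
have -> : - q * p = 1 - p by rewrite /q; field.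
have -> : q / p * p = q by field.
have -> : q / q = 1 by field.
have -> : - (q / p) / q = - p^-1 by field; rewrite pn qn.
rewrite invrK (powRr1 (ltW s0)); apply: lerD.
  by rewrite le_eqVlt; apply/orP; left; apply/eqP; ring.
rewrite [leLHS](_ : _ = q * (s * m `^ (- p^-1)) * y `^ q^-1); last by ring.
apply: ler_wpM2l; first by rewrite !mulr_ge0 ?powR_ge0 ?ltW.
have [->|yn] := eqVneq y 0; first by rewrite powR0 ?invr_neq0// expr2 mulr0.
by rewrite -powR_mulrn//; apply: ger_powR => //; rewrite y1 lt0r yn y0.
Qed.

(** The l^2 norm is at most the l^p norm for [p <= 2], and the latter is bounded
    by the tangent at [s ^ p]: a form that can be integrated when only the
    p-th moments are finite. *)
Lemma sqrt_sum_sqr_le_tangent p s (u : nat -> R) (T : nat) :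
    1 < p <= 2 -> 0 < s ->
  Num.sqrt (\sum_(1 <= t < T.+1) u t ^+ 2) <=
  s * (1 - p^-1 + p^-1 * ((\sum_(1 <= t < T.+1) `|u t| `^ p) / s `^ p)).
Proof.
move=> /andP[p1 p2] s0; set A := \sum_(1 <= t < T.+1) `|u t| `^ p.
have p0 : 0 < p by lra.
have pn : p != 0 by rewrite gt_eqF.
have A0 : 0 <= A by apply: sumr_ge0 => i _; exact: powR_ge0.
have pV : 0 < p^-1 <= 1 by rewrite invr_gt0 p0 invf_le1//; lra.
have sp : 0 < s `^ p by rewrite powR_gt0.
apply: (@le_trans _ _ (A `^ p^-1)); last first.
  have := powR_le_tangent pV sp A0.
  by rewrite -powRrM mulfV// powRr1// ltW.
rewrite -(@ler_pXn2r R 2) ?nnegrE ?sqrtr_ge0 ?powR_ge0//.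
rewrite sqr_sqrtr; last by apply: sumr_ge0 => i _; exact: sqr_ge0.
have sqE t : u t ^+ 2 = (`|u t| `^ p) `^ (2 / p).
  rewrite -powRrM mulrC divfK// powR_mulrn// -normrX ger0_norm ?sqr_ge0//.
have [A00|An] := eqVneq A 0.
  rewrite big_nat big1 ?sqr_ge0// => t tT.
  move/eqP: A00; rewrite /A big_nat psumr_eq0 => [|i _]; last exact: powR_ge0.
  move/allP => /(_ t); rewrite mem_index_iota tT => /(_ isT)/= /eqP.
  by move=> /powR_eq0_eq0/normr0_eq0 ->; rewrite expr0n.
have Ap : 0 < A by rewrite lt0r An.
have p2V : 1 <= 2 / p by rewrite ler_pdivlMr// mul1r.
have -> : (A `^ p^-1) ^+ 2 = \sum_(1 <= t < T.+1) A `^ (2 / p) * (`|u t| `^ p / A).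
  rewrite -mulr_sumr -mulr_suml divff// mulr1.
  by rewrite -powR_mulrn ?powR_ge0// -powRrM mulrC.
rewrite !big_nat; apply: ler_sum => t tT; rewrite sqE.
have tA : `|u t| `^ p <= A.
  rewrite /A (bigD1_seq t)/= ?iota_uniq ?mem_index_iota// lerDl.
  by apply: sumr_ge0 => i _; exact: powR_ge0.
have a0 : 0 <= `|u t| `^ p by exact: powR_ge0.
move: (`|u t| `^ p) a0 tA => a a0 aA.
rewrite -[in leLHS](divfK An a) powRM ?divr_ge0 ?(ltW Ap)// mulrC ler_pM2l ?powR_gt0//.
have [->|an] := eqVneq a 0; first by rewrite mul0r powR0// gt_eqF// divr_gt0.
apply: ge1r_powR => //.
by rewrite ler_pdivrMr// mul1r aA andbT divr_gt0// lt0r an.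
Qed.

(** Optimising over [s] at [sqrt (w / q)]; when [w = 0] the infimum is a limit. *)
Lemma le_two_sqrt x b q w : 0 < q -> 0 <= w ->
  (forall s, 0 < s -> x <= b + s * q + w / s) -> x <= b + 2 * Num.sqrt (q * w).
Proof.
move=> q0 w0 H.
move: w0; rewrite le_eqVlt => /predU1P[w0|w0].
  rewrite -w0 mulr0 sqrtr0 mulr0 addr0; apply/ler_addgt0Pr => e e0.
  have := H (e / q); rewrite divr_gt0// => /(_ isT).
  by rewrite -w0 mul0r addr0 divfK ?gt_eqF.
have := H (Num.sqrt (w / q)); rewrite sqrtr_gt0 divr_gt0// => /(_ isT).
have sq : 0 < Num.sqrt q by rewrite sqrtr_gt0.
have sw : 0 < Num.sqrt w by rewrite sqrtr_gt0.
rewrite -{2}(sqr_sqrtr (ltW q0)) -{2}(sqr_sqrtr (ltW w0)).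
rewrite (sqrtrM _ (ltW w0)) (sqrtrM _ (ltW q0)) sqrtrV ?(ltW q0)//.
have -> : Num.sqrt w / Num.sqrt q * Num.sqrt q ^+ 2 = Num.sqrt q * Num.sqrt w.
  by field; rewrite gt_eqF.
have -> : Num.sqrt w ^+ 2 / (Num.sqrt w / Num.sqrt q) = Num.sqrt q * Num.sqrt w.
  by field; rewrite !gt_eqF.
lra.
Qed.

(** A self-bounding inequality for the gradient norm [x]: the quadratic [x ^+ 2]
    absorbs the terms in [x] on the right. *)
Lemma self_bounding l s x b n : 0 < l -> 0 < s -> 0 <= x -> 0 <= b -> 0 <= n ->
  x ^+ 2 <= b * (l + 3 * x + 2 * n) -> x <= 4 * b + l + s * b + n / s.
Proof.
move=> l0 s0 x0 b0 n0 H; rewrite leNgt; apply/negP => xb.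
have sb : 0 <= s * b by rewrite mulr_ge0// ltW.
have ns : 0 <= n / s by rewrite divr_ge0// ltW.
have xp : 0 < x by lra.
have h1 : n * b <= x * (n / s).
  have -> : n * b = (s * b) * (n / s) by field; rewrite gt_eqF.
  by apply: ler_wpM2r => //; lra.
have h2 : n * b <= x * (s * b).
  have -> : n * b = (n / s) * (s * b) by field; rewrite gt_eqF.
  by apply: ler_wpM2r => //; lra.
have h3 : b * l <= x * b by rewrite mulrC; apply: ler_wpM2r => //; lra.
have h4 : x * (4 * b + l + s * b + n / s) < x * x by rewrite ltr_pM2l.
have h5 : 0 < x * l by rewrite mulr_gt0.
move: H h4; rewrite expr2; nra.
Qed.

(** Cauchy-Schwarz against the constant sequence. *)
Lemma sum_norm_le_l2 (u : nat -> R) (T : nat) : (0 < T)%N ->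
  \sum_(1 <= t < T.+1) `|u t| <=
  Num.sqrt T%:R * Num.sqrt (\sum_(1 <= t < T.+1) u t ^+ 2).
Proof.
move=> T0; set A := \sum_(1 <= t < T.+1) u t ^+ 2.
have A0 : 0 <= A by apply: sumr_ge0 => t _; exact: sqr_ge0.
have TR : 0 < T%:R :> R by rewrite ltr0n.
rewrite -sqrtrM ?ler0n// mulrC.
have -> : Num.sqrt (A * T%:R) = 0 + 2 * Num.sqrt ((T%:R / 4) * A).
  have -> : A * T%:R = 2 ^+ 2 * (T%:R / 4 * A) by field.
  by rewrite sqrtrM ?sqr_ge0// sqrtr_sqr ger0_norm// add0r.
apply: le_two_sqrt => // [|s s0]; first by rewrite divr_gt0.
rewrite add0r /A mulr_suml.
have -> : s * (T%:R / 4) = \sum_(1 <= t < T.+1) s / 4.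
  by rewrite sumr_const_nat subn1 -[RHS]mulr_natl; ring.
rewrite -big_split/=; apply: ler_sum => t _.
rewrite -(real_normK (num_real (u t))).
have : 0 <= (`|u t| - s / 2) ^+ 2 / s by rewrite divr_ge0 ?sqr_ge0// ltW.
have -> : (`|u t| - s / 2) ^+ 2 / s = `|u t| ^+ 2 / s - `|u t| + s / 4.
  by field; rewrite gt_eqF.
lra.
Qed.

End RealInequalities.

(** * Expectations and conditional expectations *)

Definition intg d (T : measurableType d) (R : realType) (P : probability T R)
  (X : T -> R) : Prop := P.-integrable setT (EFin \o X).

Definition mean d (T : measurableType d) (R : realType) (P : probability T R)
  (X : T -> R) : R := \int[P]_w X w.

Section Mean.
Context d (T : measurableType d) (R : realType) (P : probability T R).
Implicit Types (X Y Z : T -> R) (c M : R).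

Lemma intg_measurable X : intg P X -> measurable_fun setT X.
Proof. by move/measurable_int/measurable_EFinP. Qed.

Lemma intg_cst c : intg P (fun=> c).
Proof. exact: finite_measure_integrable_cst. Qed.

Lemma intgD X Y : intg P X -> intg P Y -> intg P (fun w => X w + Y w).
Proof. by move=> iX iY; exact: (integrableD _ iX iY). Qed.

Lemma intgB X Y : intg P X -> intg P Y -> intg P (fun w => X w - Y w).
Proof. by move=> iX iY; exact: (integrableB _ iX iY). Qed.

Lemma intgZ c X : intg P X -> intg P (fun w => c * X w).
Proof. by move=> iX; exact: (integrableZl _ c iX). Qed.

Lemma intg_norm X : intg P X -> intg P (fun w => `|X w|).
Proof. by move=> iX; exact: integrable_norm. Qed.

Lemma intg_sum (I : Type) (r : seq I) (p : pred I) (F : I -> T -> R) :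
  (forall i, p i -> intg P (F i)) -> intg P (fun w => \sum_(i <- r | p i) F i w).
Proof.
move=> H; rewrite /intg.
rewrite (_ : EFin \o _ = fun w => (\sum_(i <- r | p i) (F i w)%:E)%E).
  by apply: integrable_sum => // i /H.
by apply/funext => w /=; rewrite sumEFin.
Qed.

Lemma intg_bounded X M : measurable_fun setT X -> (forall w, `|X w| <= M) ->
  intg P X.
Proof.
move=> mX XM; apply: measurable_bounded_integrable => //=.
  by rewrite (le_lt_trans (probability_le1 _ _)) ?ltry.
exists M; split; first exact: num_real.
by move=> x xM w _ /=; rewrite (le_trans (XM w))// ltW.
Qed.

Lemma intgM_bounded Z X M : measurable_fun setT Z -> (forall w, `|Z w| <= M) ->
  intg P X -> intg P (fun w => Z w * X w).
Proof.
move=> mZ ZM iX; apply: (@integrableMr _ _ _ P setT measurableT Z (EFin \o X)) => //.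
exists M; split; first exact: num_real.
by move=> x xM w _ /=; rewrite (le_trans (ZM w))// ltW.
Qed.

Lemma intg_dominated X Y : measurable_fun setT X -> (forall w, `|X w| <= Y w) ->
  intg P Y -> intg P X.
Proof.
move=> mX XY iY; apply: (le_integrable _ _ _ iY) => //.
  exact/measurable_EFinP.
by move=> w _ /=; rewrite lee_fin (le_trans (XY w))// ler_norm.
Qed.

Lemma mean_cst c : mean P (fun=> c) = c.
Proof.
by rewrite /mean Rintegral_cst//= probability_setT/= mulr1.
Qed.

Lemma meanD X Y : intg P X -> intg P Y ->
  mean P (fun w => X w + Y w) = mean P X + mean P Y.
Proof. by move=> iX iY; rewrite /mean RintegralD. Qed.

Lemma meanB X Y : intg P X -> intg P Y ->
  mean P (fun w => X w - Y w) = mean P X - mean P Y.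
Proof. by move=> iX iY; rewrite /mean RintegralB. Qed.

Lemma meanZ c X : intg P X -> mean P (fun w => c * X w) = c * mean P X.
Proof. by move=> iX; rewrite /mean RintegralZl. Qed.

Lemma mean_le X Y : intg P X -> intg P Y -> (forall w, X w <= Y w) ->
  mean P X <= mean P Y.
Proof. by move=> iX iY XY; rewrite /mean le_Rintegral. Qed.

Lemma mean_ge0 X : (forall w, 0 <= X w) -> 0 <= mean P X.
Proof. by move=> X0; rewrite /mean Rintegral_ge0. Qed.

Lemma eq_mean X Y : X =1 Y -> mean P X = mean P Y.
Proof. by move=> /funext ->. Qed.

Lemma le_norm_mean X : intg P X -> `|mean P X| <= mean P (fun w => `|X w|).
Proof. by move=> iX; exact: le_normr_Rintegral. Qed.

Lemma mean_sum (I : Type) (r : seq I) (F : I -> T -> R) :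
  (forall i, intg P (F i)) ->
  mean P (fun w => \sum_(i <- r) F i w) = \sum_(i <- r) mean P (F i).
Proof.
move=> H; elim: r => [|i r IH].
  by rewrite big_nil -[RHS](mean_cst 0); apply: eq_mean => w; rewrite big_nil.
rewrite big_cons -IH -meanD//; last exact: intg_sum.
by apply: eq_mean => w; rewrite big_cons.
Qed.

Lemma intg_sum_nat (F : nat -> T -> R) m :
  (forall t, (1 <= t < m)%N -> intg P (F t)) ->
  intg P (fun w => \sum_(1 <= t < m) F t w) /\
  mean P (fun w => \sum_(1 <= t < m) F t w) = \sum_(1 <= t < m) mean P (F t).
Proof.
move=> H; pose F' t := if (1 <= t < m)%N then F t else fun=> 0.
have iF' t : intg P (F' t).
  by rewrite /F'; case: ifP => [/H//|_]; exact: intg_cst.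
have -> : (fun w => \sum_(1 <= t < m) F t w) = (fun w => \sum_(1 <= t < m) F' t w).
  by apply/funext => w; rewrite !big_nat; apply: eq_bigr => t tm; rewrite /F' tm.
split; first exact: intg_sum.
by rewrite mean_sum// !big_nat; apply: eq_bigr => t tm; rewrite /F' tm.
Qed.

Lemma integral_set_indic A X : measurable A ->
  (\int[P]_(w in A) (X w)%:E)%E = (\int[P]_w (\1_A w * X w)%:E)%E.
Proof.
move=> mA; rewrite [LHS]integral_mkcond; apply: eq_integral => w _.
by rewrite patchE indicE; case: ifPn => _; rewrite ?mul1r ?mul0r.
Qed.

End Mean.

Definition adapted d (T : measurableType d) (R : realType) (C : set (set T))
  (Z : T -> R) : Prop :=
  measurable_fun (setT : set (g_sigma_algebraType C))
    (Z : g_sigma_algebraType C -> R).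

Section MeasurableOperations.
Context d (T : measurableType d) (R : realType).
Implicit Types X Y : T -> R.

Lemma measurable_sqrt_comp X : measurable_fun setT X ->
  measurable_fun setT (fun w => Num.sqrt (X w)).
Proof.
move=> mX; apply: (measurableT_comp _ mX).
by apply: continuous_measurable_fun; exact: sqrt_continuous.
Qed.

Lemma measurable_powR_comp X p : measurable_fun setT X ->
  measurable_fun setT (fun w => X w `^ p).
Proof. by move=> mX; apply: (measurableT_comp (measurable_powR p) mX). Qed.

Lemma measurable_norm_comp X : measurable_fun setT X ->
  measurable_fun setT (fun w => `|X w|).
Proof. by move=> mX; apply: measurableT_comp. Qed.

Lemma measurable_div_comp X Y : measurable_fun setT X -> measurable_fun setT Y ->
  (forall w, 0 <= Y w) -> measurable_fun setT (fun w => X w / Y w).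
Proof.
move=> mX mY Y0; apply: measurable_funM => //.
rewrite (_ : (fun w => _) = (fun w => Y w `^ (-1))).
  exact: measurable_powR_comp.
by apply/funext => w; rewrite powR_inv1.
Qed.

Lemma measurable_add_comp X Y : measurable_fun setT X -> measurable_fun setT Y ->
  measurable_fun setT (fun w => X w + Y w).
Proof. exact: measurable_funD. Qed.

Lemma measurable_mul_comp X Y : measurable_fun setT X -> measurable_fun setT Y ->
  measurable_fun setT (fun w => X w * Y w).
Proof. exact: measurable_funM. Qed.

Lemma measurable_opp_comp X : measurable_fun setT X ->
  measurable_fun setT (fun w => - X w).
Proof. by move=> mX; apply: measurableT_comp. Qed.

End MeasurableOperations.

(* Discharges measurability goals for expressions built from arithmetic
   operations, square roots, real powers and case distinctions. *)
Ltac measurability := repeat first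
  [ assumption
  | match goal with
    | H : forall _, measurable_fun _ _ |- _ => solve [apply: H]
    | |- measurable_fun _ (fun w => _ + _) => apply: measurable_add_comp
    | |- measurable_fun _ (fun w => _ / _) => apply: measurable_div_comp
    | |- measurable_fun _ (fun w => _ * _) => apply: measurable_mul_comp
    | |- measurable_fun _ (fun w => _ ^+ _) => apply: measurable_funX
    | |- measurable_fun _ (fun w => - _) => apply: measurable_opp_comp
    | |- measurable_fun _ (fun w => `|_|) => apply: measurable_norm_comp
    | |- measurable_fun _ (fun w => Num.sqrt _) => apply: measurable_sqrt_comp
    | |- measurable_fun _ (fun w => _ `^ _) => apply: measurable_powR_comp
    | |- measurable_fun _ (fun w => \sum_(_ <- _) _) => apply: measurable_sum => ?
    | |- measurable_fun _ (fun w => if _ then _ else _) => apply: measurable_fun_ifT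
    | |- measurable_fun _ (fun w => _ < _) => apply: measurable_fun_ltr
    | |- measurable_fun _ (fun w => _ <= _) => apply: measurable_fun_ler
    end
  | exact: measurable_cst ].

Section ConditionalExpectation.
Context d (T : measurableType d) (R : realType) (P : probability T R).
Variable C : set (set T).
Hypothesis sC : <<s C>> `<=` measurable.
Implicit Types (X Y Z U : T -> R) (M : R).

Lemma adapted_measurable Z : adapted C Z -> measurable_fun setT Z.
Proof. by move=> mZ _ B mB; apply: sC; exact: (mZ measurableT). Qed.

Lemma adapted_le_event X Y : adapted C X -> adapted C Y ->
  <<s C>> [set w | X w <= Y w].
Proof.
move=> aX aY; have := @measurable_fun_ler _ (g_sigma_algebraType C) R setT
  X Y aX aY measurableT [set true].
rewrite setTI => H; rewrite (_ : [set w | _] = (fun w => X w <= Y w) @^-1` [set true]).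
  exact: H.
by apply/seteqP; split => w.
Qed.

Lemma indic_bounded (A : set T) w : `|(\1_A w : R)| <= 1.
Proof. by rewrite indicE ger0_norm ?ler_nat; case: (w \in A). Qed.

Lemma adapted_indic A : <<s C>> A -> adapted C (\1_A : T -> R).
Proof. by move=> CA; apply: (@measurable_indic _ (g_sigma_algebraType C)). Qed.

(** [U] has conditional expectation [0]: the form in which the defining
    property of conditional expectations is used. *)
Definition null_on U : Prop :=
  intg P U /\ forall A, <<s C>> A -> mean P (fun w => \1_A w * U w) = 0.

Lemma is_cond_expectation_null_on X Y :
  is_cond_expectation P <<s C>> X Y -> null_on (fun w => X w - Y w).
Proof.
move=> [iX iY mY eXY]; split; first exact: intgB.
move=> A CA; have mA := sC CA.
have mi := adapted_measurable (adapted_indic CA).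
rewrite (_ : (fun w => _) = (fun w => \1_A w * X w - \1_A w * Y w)); last first.
  by apply/funext => w; rewrite mulrBr.
rewrite meanB; [|exact: intgM_bounded (@indic_bounded A) _..].
rewrite /mean /Rintegral -!integral_set_indic//.
by move: (eXY A CA) => ->; rewrite subrr.
Qed.

(* The largest multiple of [e] below [z], capped at [N * e]. *)
Let stair (e z : R) N : R := \sum_(k < N) e * (k.+1%:R * e <= z)%R%:R.

Let stairP (e z : R) N : 0 < e -> 0 <= z ->
  (N%:R * e <= z -> stair e z N = N%:R * e) /\
  (z <= N%:R * e -> 0 <= z - stair e z N <= e).
Proof.
move=> e0 z0; elim: N => [|N [IH1 IH2]].
  rewrite /stair big_ord0 mul0r; split=> // ze.
  by have -> : z = 0 by [lra]; rewrite subrr lexx ltW.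
have Ne : N.+1%:R * e = N%:R * e + e by rewrite -natr1 mulrDl mul1r.
rewrite /stair big_ord_recr/= -/(stair e z N); split=> h.
  rewrite h mulr1 IH1; first by rewrite Ne.
  by move: h; rewrite Ne; lra.
case: (leP z (N%:R * e)) => hz.
  have -> : (N.+1%:R * e <= z) = false by apply/negbTE; rewrite -ltNge Ne; lra.
  by rewrite mulr0 addr0 IH2.
rewrite (IH1 (ltW hz)); move: h; rewrite Ne => h.
by case: (leP (N%:R * e + e) z) => h'; rewrite ?mulr0 ?mulr1; lra.
Qed.

(** Taking out what is known. The staircase functions below a bounded adapted
    [Z] are combinations of indicators of events of the sub-sigma-algebra, and
    they converge to [Z] uniformly. *)
Lemma null_on_mul U Z M : null_on U -> adapted C Z -> (forall w, `|Z w| <= M) ->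
  mean P (fun w => Z w * U w) = 0.
Proof.
move=> [iU nU] aZ ZM; have mZ := adapted_measurable aZ.
have mi A : <<s C>> A -> measurable_fun setT (\1_A : T -> R).
  by move=> CA; exact: adapted_measurable (adapted_indic CA).
have iZU := intgM_bounded mZ ZM iU.
have CT : <<s C>> setT by exact: (@measurableT _ (g_sigma_algebraType C)).
have U0 : mean P U = 0.
  by rewrite -(nU _ CT); apply: eq_mean => w; rewrite indicT mul1r.
have M0 : 0 <= M by rewrite (le_trans _ (ZM point)).
apply/eqP; rewrite -normr_le0; apply/ler_addgt0Pr => e e0; rewrite add0r.
set mU := mean P (fun w => `|U w|).
have mU0 : 0 <= mU by exact: mean_ge0.
pose h := e / (mU + 1).
have h0 : 0 < h by rewrite divr_gt0// ltr_wpDl.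
pose N := Num.bound (2 * M / h).
have NM : 2 * M <= N%:R * h.
  rewrite -ler_pdivrMr//; apply/ltW/archi_boundP.
  exact: (divr_ge0 (mulr_ge0 (ler0n _ 2) M0) (ltW h0)).
have Zpos w : 0 <= Z w + M by have := ZM w; rewrite ler_norml; lra.
pose A (k : nat) := [set w | k.+1%:R * h <= Z w + M].
have CA k : <<s C>> (A k).
  apply: adapted_le_event; first exact: measurable_cst.
  by apply: measurable_funD => //; exact: measurable_cst.
have SE w : stair h (Z w + M) N = \sum_(k < N) h * \1_(A k) w.
  apply: eq_bigr => k _; rewrite indicE; congr (_ * (nat_of_bool _)%:R).
  by apply/idP/idP => [H|/set_mem//]; exact/mem_set.
have mS : measurable_fun setT (fun w => stair h (Z w + M) N).
  under eq_fun do rewrite SE.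
  apply: measurable_sum => k; apply: measurable_funM; first exact: measurable_cst.
  exact: mi.
have close w : `|Z w + M - stair h (Z w + M) N| <= h.
  have [_ H] := stairP N h0 (Zpos w).
  have /H/andP[H1 H2] : Z w + M <= N%:R * h.
    by apply: le_trans NM; have := ZM w; rewrite ler_norml; lra.
  by rewrite ger0_norm.
have meanS : mean P (fun w => stair h (Z w + M) N * U w) = 0.
  under [X in mean P X]eq_fun do rewrite SE mulr_suml.
  rewrite mean_sum => [|k]; last first.
    under eq_fun do rewrite -mulrA.
    by apply: intgZ; exact: intgM_bounded (mi _ (CA k)) (@indic_bounded _) iU.
  rewrite big1// => k _; under [X in mean P X]eq_fun do rewrite -mulrA.
  rewrite meanZ; last exact: intgM_bounded (mi _ (CA k)) (@indic_bounded _) iU.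
  by rewrite nU ?mulr0.
have iD : intg P (fun w => (Z w + M - stair h (Z w + M) N) * U w).
  apply: (intgM_bounded _ close iU).
  by apply: measurable_funB => //; apply: measurable_funD => //.
have iS : intg P (fun w => stair h (Z w + M) N * U w).
  have -> : (fun w => stair h (Z w + M) N * U w) =
      (fun w => (Z w * U w + M * U w) - (Z w + M - stair h (Z w + M) N) * U w).
    by apply/funext => w; ring.
  by apply: intgB => //; apply: intgD => //; exact: intgZ.
have -> : mean P (fun w => Z w * U w) =
    mean P (fun w => (Z w + M - stair h (Z w + M) N) * U w).
  have : mean P (fun w => (Z w * U w + M * U w) - stair h (Z w + M) N * U w) =
      mean P (fun w => Z w * U w).
    rewrite meanB// ?meanS ?subr0; last by apply: intgD => //; exact: intgZ.
    by rewrite meanD//; [rewrite meanZ// U0 mulr0 addr0|exact: intgZ].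
  by move=> <-; apply: eq_mean => w; ring.
apply: le_trans (le_norm_mean iD) _.
apply: (@le_trans _ _ (h * mU)).
  rewrite -meanZ; last exact: intg_norm.
  apply: mean_le; [exact: intg_norm|by apply: intgZ; exact: intg_norm|].
  by move=> w; rewrite normrM ler_wpM2r.
rewrite /h mulrAC ler_pdivrMr ?ltr_wpDl// ler_wpM2l ?(ltW e0)//.
by rewrite lerDl.
Qed.


(** A version of the conditional expectation of a variable with values in
    [[0, 1]] can be clipped to [[0, 1]], since it leaves this interval on null
    sets only. *)
Lemma clip_cond_mean X Y0 : intg P X -> (forall w, 0 <= X w <= 1) ->
    intg P Y0 -> adapted C Y0 -> null_on (fun w => X w - Y0 w) ->
  exists Y, [/\ adapted C Y, (forall w, 0 <= Y w <= 1) &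
                null_on (fun w => X w - Y w)].
Proof.
move=> iX X01 iY0 aY0 [_ nXY].
have iI A Z : <<s C>> A -> intg P Z -> intg P (fun w => \1_A w * Z w).
  move=> CA iZ.
  exact: intgM_bounded (adapted_measurable (adapted_indic CA)) (@indic_bounded _) iZ.
have eY0 A : <<s C>> A ->
    mean P (fun w => \1_A w * X w) = mean P (fun w => \1_A w * Y0 w).
  move=> CA; apply/eqP; rewrite -subr_eq0 -meanB; [|exact: iI..].
  by rewrite -(nXY A CA); apply/eqP/eq_mean => w; ring.
pose Y w := Num.max 0 (Num.min 1 (Y0 w)).
have aY : adapted C Y.
  apply: (@measurable_maxr _ (g_sigma_algebraType C)) => //.
  by apply: (@measurable_minr _ (g_sigma_algebraType C)).
have Y01 w : 0 <= Y w <= 1.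
  by rewrite /Y le_max lexx ge_max ler01 ge_min lexx.
have iY : intg P Y.
  apply: (@intg_bounded _ _ _ _ _ 1); first exact: adapted_measurable.
  by move=> w; rewrite ger0_norm; case/andP: (Y01 w).
exists Y; split => //; split; first exact: intgB.
move=> A CA.
(* The events on which clipping changes [Y0]. *)
pose B1 := [set w | 1 <= Y0 w]; pose B0 := [set w | Y0 w <= 0].
have CB1 : <<s C>> B1 by apply: adapted_le_event => //; exact: measurable_cst.
have CB0 : <<s C>> B0 by apply: adapted_le_event => //; exact: measurable_cst.
have CI B : <<s C>> B -> <<s C>> (A `&` B).
  by move=> CB; exact: (@measurableI _ (g_sigma_algebraType C)).
have dec w : Y0 w - Y w = \1_B1 w * (Y0 w - 1) + \1_B0 w * Y0 w.
  rewrite /Y !indicE; case: (lerP 1 (Y0 w)) => h1.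
    rewrite max_r// mem_set// memNset/=; first by rewrite mul1r mul0r addr0.
    by rewrite /B0/=; apply/negP; rewrite -ltNge; lra.
  rewrite [_ \in B1]memNset/=; last by rewrite /B1/=; apply/negP; rewrite -ltNge.
  rewrite mul0r add0r; case: (lerP (Y0 w) 0) => h0.
    by rewrite mem_set// mul1r subr0.
  rewrite memNset/= ?subrr ?mul0r//.
  by rewrite /B0/=; apply/negP; rewrite -ltNge.
have i1 : intg P (fun w => Y0 w - 1) by apply: intgB => //; exact: intg_cst.
have e1 : mean P (fun w => \1_(A `&` B1) w * (Y0 w - 1)) = 0.
  apply/eqP; rewrite eq_le; apply/andP; split; last first.
    apply: mean_ge0 => w; rewrite indicE.
    have [/set_mem[_ /= h]|_] := boolP (w \in _); last by rewrite mul0r.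
    by rewrite mul1r subr_ge0.
  have CAB := CI _ CB1.
  have -> : mean P (fun w => \1_(A `&` B1) w * (Y0 w - 1)) =
            mean P (fun w => \1_(A `&` B1) w * (X w - 1)).
    have i2 : intg P (\1_(A `&` B1) : T -> R).
      by have := iI _ _ CAB (intg_cst P 1); under eq_fun do rewrite mulr1.
    under [LHS]eq_mean do rewrite mulrBr mulr1.
    under [RHS]eq_mean do rewrite mulrBr mulr1.
    by rewrite !meanB// ?eY0//; exact: iI.
  rewrite -[leRHS](mean_cst P 0); apply: mean_le => [||w].
  - by apply: iI => //; apply: intgB => //; exact: intg_cst.
  - exact: intg_cst.
  - apply: mulr_ge0_le0; first by rewrite indicE ler0n.
    by rewrite subr_le0; case/andP: (X01 w).
have e0 : mean P (fun w => \1_(A `&` B0) w * Y0 w) = 0.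
  have CAB := CI _ CB0.
  apply/eqP; rewrite eq_le; apply/andP; split; last first.
    rewrite -eY0//; apply: mean_ge0 => w.
    by apply: mulr_ge0; [rewrite indicE ler0n|case/andP: (X01 w)].
  rewrite -[leRHS](mean_cst P 0); apply: mean_le => [||w].
  - exact: iI.
  - exact: intg_cst.
  - rewrite indicE; have [/set_mem[_ /= h]|_] := boolP (w \in _); last by rewrite mul0r.
    by rewrite mul1r.
have -> : (fun w => \1_A w * (X w - Y w)) = (fun w => (\1_A w * X w - \1_A w * Y0 w) +
    (\1_(A `&` B1) w * (Y0 w - 1) + \1_(A `&` B0) w * Y0 w)).
  apply/funext => w; rewrite !indicI/=.
  have -> : X w - Y w = (X w - Y0 w) + (Y0 w - Y w) by ring.
  by rewrite dec; ring.
have iX' := iI _ _ CA iX; have iY' := iI _ _ CA iY0.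
have j1 := iI _ _ (CI _ CB1) i1; have j0 := iI _ _ (CI _ CB0) iY0.
rewrite (meanD (intgB iX' iY') (intgD j1 j0)) (meanB iX' iY') (meanD j1 j0).
by rewrite eY0// subrr e1 e0 !addr0.
Qed.


Let nu X (A : set (g_sigma_algebraType C)) : \bar R := (\int[P]_(w in A) (X w)%:E)%E.

(** Existence of conditional expectations, by Radon-Nikodym on the
    sub-sigma-algebra: [idM] views [T] with fewer events, [mu] is the
    restriction of [P] and [nuC] that of the measure with density [X]. *)
Lemma cond_mean_exists X : measurable_fun setT X -> (forall w, 0 <= X w <= 1) ->
  exists Y, [/\ adapted C Y, (forall w, 0 <= Y w <= 1) &
                null_on (fun w => X w - Y w)].
Proof.
move=> mX X01.
have X1 w : `|X w| <= 1 by rewrite ger0_norm; case/andP: (X01 w).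
have iX := intg_bounded P mX X1.
pose S := g_sigma_algebraType C.
have mid : measurable_fun (setT : set T) (id : T -> S).
  by move=> _ B mB; rewrite setTI; exact: sC.
pose idM : {mfun T >-> S} := HB.pack (id : T -> S) (isMeasurableFun.Build _ _ _ _ _ mid).
pose mu : probability S R := distribution P idM.
have nu0 : nu X set0 = 0%E by rewrite /nu integral_set0.
have finnu (A : set S) : measurable A -> nu X A \is a fin_num.
  by move=> mA; exact: (@fin_num_measure _ _ _ (induced_charge iX)) (sC mA).
have snu : semi_sigma_additive (nu X : set S -> \bar R).
  move=> F mF tF mUF; apply: (@charge_semi_sigma_additive _ _ _ (induced_charge iX)) => //.
    by move=> n; exact: sC (mF n).
  exact: sC mUF.
pose nuC : {charge set S -> \bar R} := HB.pack (nu X : set S -> \bar R)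
  (isCharge.Build _ _ _ _ nu0 finnu snu).
have dom : nuC `<< mu.
  apply/null_content_dominatesP => A mA muA.
  rewrite /nuC/= /nu; apply: null_set_integral => //; first exact: sC.
  exact: measurable_funTS (measurable_int _ iX).
have finf w := Radon_Nikodym_fin_num w dom.
have intf := Radon_Nikodym_integrable dom.
have nuE A (mA : measurable A) := Radon_Nikodym_integral dom mA.
set f := Radon_Nikodym nuC mu in finf intf nuE.
pose Y0 (w : T) := fine (f w).
have aY0 : adapted C Y0.
  exact: (measurableT_comp (@fine_measurable _ _ measurableT) (measurable_int _ intf)).
have Y0E : EFin \o Y0 = f by apply/funext => w /=; rewrite fineK.
have iY0 : intg P Y0.
  rewrite /intg Y0E; apply/integrableP; split.
    by rewrite -Y0E; apply/measurable_EFinP; exact: adapted_measurable.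
  have /integrableP[mf] := intf.
  by rewrite /mu /distribution ge0_integral_pushforward//; exact: measurableT_comp.
have eY0 A : <<s C>> A -> mean P (fun w => \1_A w * X w) = mean P (fun w => \1_A w * Y0 w).
  move=> CA; have mA := sC CA; rewrite /mean /Rintegral -!integral_set_indic//; congr fine.
  have := nuE A CA; rewrite /= /nu => ->; rewrite /mu /distribution.
  have iYA : P.-integrable ((id : T -> S) @^-1` A) (f \o (id : T -> S)).
    by move: iY0; rewrite /intg Y0E => iY0; exact: integrableS iY0.
  have mf : measurable_fun setT f by exact: measurable_int intf.
  transitivity (\int[P]_(w in (id : T -> S) @^-1` A) ((f \o (id : T -> S)) w))%E.
    exact: (integral_pushforward mid mf iYA CA).
  by apply: eq_integral => w _ /=; rewrite fineK.
apply: (@clip_cond_mean _ Y0) => //; split; first exact: intgB.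
move=> A CA; under eq_mean do rewrite mulrBr.
have mA := adapted_measurable (adapted_indic CA).
by rewrite meanB ?eY0 ?subrr//; exact: intgM_bounded mA (@indic_bounded _) _.
Qed.

Lemma null_on_eq X Y Z M : intg P X -> intg P Y ->
    null_on (fun w => X w - Y w) -> adapted C Z -> (forall w, `|Z w| <= M) ->
  mean P (fun w => Z w * X w) = mean P (fun w => Z w * Y w).
Proof.
move=> iX iY nXY aZ ZM; have mZ := adapted_measurable aZ.
apply/eqP; rewrite -subr_eq0 -meanB; [|exact: intgM_bounded ZM _..].
by rewrite -(null_on_mul nXY aZ ZM); apply/eqP/eq_mean => w; rewrite mulrBr.
Qed.

Lemma mean_ge0_ae X : intg P X -> {ae P, forall w, 0 <= X w} -> 0 <= mean P X.
Proof.
move=> iX X0; have mX := intg_measurable iX.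
suff -> : mean P X = mean P (fun w => `|X w|) by exact: mean_ge0.
rewrite /mean /Rintegral; congr fine; apply: ae_eq_integral => //.
- exact/measurable_EFinP.
- by apply/measurable_EFinP; exact: measurable_norm_comp.
- by apply: filterS X0 => w Xw _; rewrite ger0_norm.
Qed.

Lemma cond_expectation_le_mul X a Z M :
    cond_expectation_le P <<s C>> X a -> adapted C Z ->
    (forall w, 0 <= Z w <= M) ->
  mean P (fun w => Z w * X w) <= a * mean P Z.
Proof.
move=> [Y cXY Ya] aZ Z0M; have [iX iY _ _] := cXY.
have ZM w : `|Z w| <= M by rewrite ger0_norm; case/andP: (Z0M w).
have mZ := adapted_measurable aZ.
have iZ : intg P Z := intg_bounded P mZ ZM.
rewrite (null_on_eq iX iY (is_cond_expectation_null_on cXY) aZ ZM).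
have iZY := intgM_bounded mZ ZM iY.
rewrite -meanZ// -subr_ge0 -meanB//; last exact: intgZ.
apply: mean_ge0_ae; first by apply: intgB => //; exact: intgZ.
apply: filterS Ya => w Yw; rewrite mulrC -mulrBr mulr_ge0 ?subr_ge0//.
by case/andP: (Z0M w).
Qed.

End ConditionalExpectation.

(** * One step of AdaGrad in one coordinate *)

Section PointwiseStep.
Variable R : realType.
Implicit Types (G g b bh h r Y psi : R).

(** When the estimate has the wrong sign, the noise exceeds the gradient, which
    pays for the lost progress. *)
Lemma step_large_psi G g b : 0 < b -> `|g| <= b ->
  `|G| * (`|g| / b) ^+ 2 - 2 * (`|g - G| * (`|g| / b)) <= G * g / b.
Proof.
move=> b0 gb; set psi := `|g| / b.
have psi0 : 0 <= psi by rewrite divr_ge0// ltW.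
have psi1 : psi <= 1 by rewrite ler_pdivrMr// mul1r.
have G0 := normr_ge0 G.
have [Gg|Gg] := lerP 0 (G * g).
  have -> : G * g / b = `|G| * psi.
    by rewrite -(ger0_norm Gg) normrM mulrA.
  have : 0 <= `|g - G| * psi by rewrite mulr_ge0.
  have : `|G| * psi ^+ 2 <= `|G| * psi by rewrite ler_wpM2l// expr2 ler_piMl.
  lra.
have -> : G * g / b = - (`|G| * psi).
  by rewrite -[G * g]opprK -(ltr0_norm Gg) normrM mulNr mulrA.
have Gxi : `|G| <= `|g - G|.
  by rewrite -[leRHS]ger0_norm// -ler_sqr ?nnegrE// !real_normK ?num_real//; nra.
have : `|G| * psi <= `|g - G| * psi by rewrite ler_wpM2r.
have : `|G| * psi ^+ 2 <= `|G| * psi by rewrite ler_wpM2l// expr2 ler_piMl.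
lra.
Qed.

(** Replacing [b] by the previous denominator [b'] costs a factor [psi]; the
    square of [psi] appears through [psi <= psi ^+ 2 + 1/4]. *)
Lemma step_small_psi G g b b' : 0 < b' -> b' <= b -> b <= b' + `|g| ->
  3 / 4 * (G ^+ 2 / b') + G / b' * (g - G) - G ^+ 2 / b' * (`|g| / b) ^+ 2
    - `|G| / b' * (`|g - G| * (`|g| / b)) <= G * g / b.
Proof.
move=> b'0 b'b bb'; have b0 : 0 < b by lra.
set psi := `|g| / b.
have psi0 : 0 <= psi by rewrite divr_ge0// ltW.
have psiE : `|g| = psi * b by rewrite /psi divfK ?gt_eqF.
have b'n : b' != 0 by rewrite gt_eqF.
have bn : b != 0 by rewrite gt_eqF.
have -> : G * g / b = G * g / b' - G * g / b' * ((b - b') / b).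
  by field; rewrite b'n bn.
have e1 : G * g / b' = G ^+ 2 / b' + G / b' * (g - G) by field.
have e2 : `|G * g / b' * ((b - b') / b)| <= `|G| / b' * `|g| * psi.
  rewrite !normrM !normfV (gtr0_norm b'0) (gtr0_norm b0).
  rewrite [leLHS](_ : _ = `|G| / b' * `|g| * (`|b - b'| / b)); last by ring.
  apply: ler_wpM2l; first by rewrite mulr_ge0// divr_ge0// ltW.
  by rewrite ler_wpM2r ?invr_ge0 ?(ltW b0)// ger0_norm; lra.
have e3 : `|g| <= `|G| + `|g - G|.
  by rewrite -[X in `|X| <= _](subrKC G) ler_normD.
have Gb : 0 <= `|G| / b' by rewrite divr_ge0// ltW.
have e4 : `|G| / b' * `|g| * psi <= G ^+ 2 / b' * psi + `|G| / b' * (`|g - G| * psi).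
  have -> : G ^+ 2 / b' * psi = `|G| / b' * (`|G| * psi).
    by rewrite -(real_normK (num_real G)); field.
  by rewrite -mulrDr -mulrDl -mulrA ler_wpM2l// ler_wpM2r.
have e5 : G ^+ 2 / b' * psi <= G ^+ 2 / b' * (psi ^+ 2 + 4^-1).
  apply: ler_wpM2l; first by rewrite divr_ge0 ?sqr_ge0// ltW.
  by have := sqr_ge0 (psi - 2^-1); lra.
by move: e2; rewrite ler_norml => /andP[_ e2]; lra.
Qed.

(** Here [r] plays the role of the conditional quadratic mean of [psi], at which
    the bound [psi <= (psi ^+ 2 / r + r) / 2] is tight. *)
Lemma step_any_psi G g b r : 0 < b -> 0 < r ->
  - (`|G| * r / 2) - `|G| / (2 * r) * (`|g| / b) ^+ 2 <= G * g / b.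
Proof.
move=> b0 r0; set psi := `|g| / b.
have rn : r != 0 by rewrite gt_eqF.
have e1 : - (`|G| * psi) <= G * g / b.
  have -> : `|G| * psi = `|G * g / b|.
    by rewrite !normrM normfV (gtr0_norm b0) mulrA.
  by rewrite lerNl -normrN ler_norm.
apply: le_trans e1; rewrite -[leRHS]mulrN.
have -> : - (`|G| * r / 2) - `|G| / (2 * r) * psi ^+ 2 =
    `|G| * (- (r / 2) - (2 * r)^-1 * psi ^+ 2) by ring.
apply: ler_wpM2l => //.
have : 0 <= (psi - r) ^+ 2 / (2 * r) by rewrite divr_ge0 ?sqr_ge0// mulr_ge0// ltW.
have -> : (psi - r) ^+ 2 / (2 * r) = (2 * r)^-1 * psi ^+ 2 - psi + r / 2 by field.
lra.
Qed.

(** The three regimes of the one-step analysis, read on the conditional second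
    moment [Y] of the normalised step and on the noise correlation bound [h]. *)
Lemma step_regimes G b' bh h r Y :
    0 < b' -> b' <= bh -> `|G| <= bh -> 0 <= h -> 0 < r -> 0 <= Y -> Y <= r ^+ 2 ->
  4^-1 * (G ^+ 2 / bh) - 4 * (h * (`|G| / bh + r)) <=
  (if 4^-1 < Y then 0 else if 4 * h < `|G| then 3 / 4 * (G ^+ 2 / b')
     else - (`|G| * r / 2))
  - (if 4^-1 < Y then 2 else if 4 * h < `|G| then `|G| / b' else 0) * h
  - (if 4^-1 < Y then - `|G| else if 4 * h < `|G| then G ^+ 2 / b'
     else `|G| / (2 * r)) * Y.
Proof.
move=> b'0 b'bh Gbh h0 r0 Y0 Yr.
have bh0 : 0 < bh by lra.
have G0 := normr_ge0 G.
set Gn := `|G| in G0 Gbh *.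
have -> : G ^+ 2 = Gn ^+ 2 by rewrite real_normK ?num_real.
have u0 : 0 <= Gn / bh by rewrite divr_ge0// ltW.
have u1 : Gn / bh <= 1 by rewrite ler_pdivrMr// mul1r.
have hu0 : 0 <= h * (Gn / bh) by rewrite mulr_ge0.
have e1 : Gn ^+ 2 / bh = Gn * (Gn / bh) by rewrite mulrA.
have e2 : Gn * (Gn / bh) <= Gn by rewrite ler_piMr.
rewrite mulrDr; case: ltP => hY.
  have r2 : 2^-1 <= r.
    by rewrite -ler_sqr ?nnegrE ?(ltW r0)//; apply: le_trans Yr; lra.
  have : h * 2^-1 <= h * r by rewrite ler_wpM2l.
  have : Gn * 4^-1 <= Gn * Y by rewrite ler_wpM2l// ltW.
  by rewrite e1; lra.
case: ltP => hG.
  have e3 : Gn ^+ 2 / bh <= Gn ^+ 2 / b'.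
    by rewrite ler_wpM2l ?sqr_ge0// lef_pV2.
  have e4 : Gn / b' * h <= 4^-1 * (Gn ^+ 2 / b').
    have -> : 4^-1 * (Gn ^+ 2 / b') = Gn / b' * (4^-1 * Gn) by ring.
    by apply: ler_wpM2l; [rewrite divr_ge0// ltW|lra].
  have e5 : Gn ^+ 2 / b' * Y <= Gn ^+ 2 / b' * 4^-1.
    by rewrite ler_wpM2l// divr_ge0 ?sqr_ge0// ltW.
  have : 0 <= h * r by rewrite mulr_ge0// ltW.
  lra.
have e3 : Gn / (2 * r) * Y <= Gn * r / 2.
  have -> : Gn * r / 2 = Gn / (2 * r) * r ^+ 2 by field; rewrite gt_eqF.
  by rewrite ler_wpM2l// divr_ge0// mulr_ge0// ltW.
have e4 : Gn * r <= 4 * h * r by rewrite ler_wpM2r// ltW.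
have e5 : Gn * (Gn / bh) <= 4 * h * (Gn / bh) by rewrite ler_wpM2r.
by rewrite e1 mul0r; lra.
Qed.

Lemma correlation_product sigma m q G bh : 0 <= sigma -> 0 < m -> 0 <= q -> 0 < bh ->
  sigma * m `^ q * (`|G| / bh + Num.sqrt m) <=
  2 * (sigma * ((G / bh) ^+ 2 + m) `^ (q + 2^-1)).
Proof.
move=> s0 m0 q0 bh0; set n := _ + m.
have mn : m <= n by rewrite /n lerDr sqr_ge0.
have n0 : 0 < n by lra.
have -> : n `^ (q + 2^-1) = n `^ q * Num.sqrt n.
  by rewrite powRD ?powR12_sqrt ?(ltW n0)// (gt_eqF n0) implybT.
have e1 : `|G| / bh <= Num.sqrt n.
  have -> : `|G| / bh = Num.sqrt ((G / bh) ^+ 2).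
    by rewrite sqrtr_sqr normrM normfV (gtr0_norm bh0).
  by rewrite ler_wsqrtr// /n lerDl ltW.
have e2 : Num.sqrt m <= Num.sqrt n by rewrite ler_wsqrtr.
have e3 : m `^ q <= n `^ q.
  by apply: ge0_ler_powR; rewrite ?nnegrE ?(ltW m0) ?(ltW n0).
rewrite -mulrA -[leRHS]mulrCA ler_wpM2l//.
have -> : 2 * (n `^ q * Num.sqrt n) = n `^ q * (Num.sqrt n + Num.sqrt n) by ring.
apply: ler_pM => //; [exact: powR_ge0| |exact: lerD].
by rewrite addr_ge0 ?sqrtr_ge0// divr_ge0// ltW.
Qed.

End PointwiseStep.

Section OneStep.
Context d (T : measurableType d) (R : realType) (P : probability T R).
Variable C : set (set T).
Hypothesis sC : <<s C>> `<=` measurable.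
Variables (p sigma delta : R) (xi psi Y : T -> R).
Hypotheses (p12 : 1 < p <= 2) (sigma0 : 0 <= sigma) (delta0 : 0 < delta).
Hypotheses (ixi : intg P xi) (mpsi : measurable_fun setT psi).
Hypothesis psi01 : forall w, 0 <= psi w <= 1.
Hypotheses (aY : adapted C Y) (Y01 : forall w, 0 <= Y w <= 1).
Hypothesis psiY : null_on P C (fun w => psi w ^+ 2 - Y w).
Hypothesis moment :
  cond_expectation_le P <<s C>> (fun w => `|xi w| `^ p) (sigma `^ p).

Let q := 1 - p^-1.
(* The shift by [delta] keeps [m] away from [0], where [m `^ (- p^-1)] is used. *)
Let m w := Y w + delta.

Let p0 : 0 < p. Proof. by case/andP: p12; lra. Qed.
Let q01 : 0 < q < 1.
Proof.
case/andP: p12 => p1 _; have : p^-1 < 1 by rewrite invf_lt1.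
have : 0 < p^-1 by rewrite invr_gt0.
by rewrite /q; lra.
Qed.
Let m_ge w : delta <= m w. Proof. by rewrite /m; case/andP: (Y01 w); lra. Qed.
Let m_gt0 w : 0 < m w. Proof. exact: lt_le_trans (m_ge w). Qed.
Let m_le w : m w <= 1 + delta. Proof. by rewrite /m; case/andP: (Y01 w); lra. Qed.

Let am : adapted C m.
Proof. by apply: measurable_funD => //; exact: measurable_cst. Qed.

Let mq_le r w : 0 <= r -> m w `^ r <= (1 + delta) `^ r.
Proof.
move=> r0; apply: ge0_ler_powR; rewrite ?nnegrE ?m_le ?(ltW (m_gt0 w))//.
by rewrite addr_ge0// ltW.
Qed.

(** The correlation between the noise and the normalised step: conditionally on
    the past it is at most [sigma * m `^ (1 - 1/p)], by the weighted Young
    inequality. The noise level is enlarged by [e] so that the weights stay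
    meaningful when [sigma = 0]. *)
Lemma noise_correlation k M : adapted C k -> (forall w, 0 <= k w <= M) ->
  mean P (fun w => k w * (`|xi w| * psi w)) <=
  mean P (fun w => k w * (sigma * m w `^ q)).
Proof.
move=> ak kM; have mk := adapted_measurable sC ak.
have k0 w : 0 <= k w by case/andP: (kM w).
have kleM w : k w <= M by case/andP: (kM w).
have M0 : 0 <= M by rewrite (le_trans (k0 point)).
have /andP[q0 q1] := q01.
have mm := adapted_measurable sC am.
have mxi := intg_measurable ixi.
have [V cV _] := moment; have [iXp _ _ _] := cV.
have iPsi2 : intg P (fun w => psi w ^+ 2).
  apply: (@intg_bounded _ _ _ _ _ 1) => [|w]; first by measurability.
  by have /andP[a b] := psi01 w; rewrite ger0_norm ?sqr_ge0// exprn_ile1.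
have imq : intg P (fun w => k w * m w `^ q).
  apply: (@intg_bounded _ _ _ _ _ (M * (1 + delta) `^ q)) => [|w].
    by measurability.
  rewrite ger0_norm ?mulr_ge0 ?powR_ge0//.
  by apply: ler_pM; rewrite ?powR_ge0// mq_le// ltW.
have iL : intg P (fun w => k w * (`|xi w| * psi w)).
  apply: (@intg_dominated _ _ _ _ _ (fun w => M * `|xi w|)) => [|w|].
  - by measurability.
  - have /andP[a b] := psi01 w.
    rewrite normrM (ger0_norm (k0 w)) normrM normr_id (ger0_norm a).
    by apply: ler_pM => //; [rewrite mulr_ge0|rewrite ler_piMr].
  - by apply: intgZ; exact: intg_norm.
suff H e : 0 < e -> mean P (fun w => k w * (`|xi w| * psi w)) <=
    (sigma + e) * mean P (fun w => k w * m w `^ q).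
  rewrite (@eq_mean _ _ _ _ (fun w => k w * (sigma * m w `^ q))
      (fun w => sigma * (k w * m w `^ q))) => [|w]; last by ring.
  rewrite meanZ//; set b := mean P (fun w => k w * m w `^ q) in H *.
  have b0 : 0 <= b by apply: mean_ge0 => w; rewrite mulr_ge0 ?powR_ge0.
  apply/ler_addgt0Pr => e e0.
  have := H (e / (b + 1)); rewrite divr_gt0 ?ltr_wpDl// => /(_ isT)/le_trans; apply.
  rewrite mulrDl lerD2l mulrAC ler_pdivrMr ?ltr_wpDl// ler_wpM2l ?(ltW e0)//.
  by rewrite lerDl.
move=> e0; set s := sigma + e.
have s0 : 0 < s by rewrite ltr_wpDl.
pose c1 := p^-1 * s `^ (1 - p); pose c2 := q * s.
pose A w := c1 * (k w * m w `^ q).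
pose B w := c2 * (k w * m w `^ (- p^-1)).
have c10 : 0 <= c1 by rewrite mulr_ge0 ?powR_ge0// invr_ge0 ltW.
have c20 : 0 <= c2 by rewrite mulr_ge0// ltW.
have pV0 : 0 <= p^-1 by rewrite invr_ge0 ltW.
have mV w : m w `^ (- p^-1) <= delta `^ (- p^-1).
  rewrite !powRN lef_pV2 ?posrE ?powR_gt0//.
  apply: ge0_ler_powR => //; rewrite ?nnegrE ?m_ge ?(ltW (m_gt0 w))//.
  exact: ltW.
have A0M w : 0 <= A w <= c1 * (M * (1 + delta) `^ q).
  rewrite /A !mulr_ge0 ?powR_ge0//= ler_wpM2l// ler_pM ?powR_ge0// mq_le//.
  exact: ltW.
have B0M w : 0 <= B w <= c2 * (M * delta `^ (- p^-1)).
  rewrite /B; apply/andP; split.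
    by apply: (mulr_ge0 c20); rewrite mulr_ge0 ?powR_ge0.
  by apply: (ler_wpM2l c20); apply: ler_pM; rewrite ?powR_ge0.
have nA w : `|A w| <= c1 * (M * (1 + delta) `^ q).
  by rewrite ger0_norm; case/andP: (A0M w).
have nB w : `|B w| <= c2 * (M * delta `^ (- p^-1)).
  by rewrite ger0_norm; case/andP: (B0M w).
have aA : adapted C A by rewrite /adapted /A; move: ak am; rewrite /adapted => *; measurability.
have aB : adapted C B by rewrite /adapted /B; move: ak am; rewrite /adapted => *; measurability.
have iY : intg P Y.
  apply: (@intg_bounded _ _ _ _ _ 1) => [|w]; first exact: adapted_measurable aY.
  by rewrite ger0_norm; case/andP: (Y01 w).
have mA := adapted_measurable sC aA.
have mB := adapted_measurable sC aB.
have iAX := intgM_bounded mA nA iXp.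
have iBY := intgM_bounded mB nB iY.
have iBp := intgM_bounded mB nB iPsi2.
have step1 : mean P (fun w => k w * (`|xi w| * psi w)) <=
    mean P (fun w => A w * `|xi w| `^ p + B w * psi w ^+ 2).
  apply: mean_le => // [|w]; first exact: intgD.
  have := @young_weighted R p s (m w) `|xi w| (psi w) p12 s0 (m_gt0 w) (normr_ge0 _) (psi01 w).
  move=> /(ler_wpM2l (k0 w)) /le_trans; apply.
  by rewrite /A /B /c1 /c2 -/q le_eqVlt; apply/orP; left; apply/eqP; ring.
apply: (le_trans step1); rewrite meanD//.
have eA := cond_expectation_le_mul sC moment aA A0M.
have eB := null_on_eq sC iPsi2 iY psiY aB nB.
have iA : intg P A by exact: intg_bounded mA nA.
rewrite eB; apply: le_trans (lerD eA (lexx _)) _.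
have sp : sigma `^ p <= s `^ p.
  apply: ge0_ler_powR; rewrite ?nnegrE ?(ltW p0) ?(ltW s0)//.
  by rewrite /s lerDl ltW.
have mA0 : 0 <= mean P A by apply: mean_ge0 => w; case/andP: (A0M w).
apply: le_trans (lerD (ler_wpM2r mA0 sp) (lexx _)) _.
rewrite -!meanZ// -meanD//; last exact: intgZ.
apply: mean_le => [||w]; [by apply: intgD => //; exact: intgZ|exact: intgZ|].
have ss : s `^ p * s `^ (1 - p) = s.
  by rewrite -powRD ?subrKC ?powRr1 ?(ltW s0)// gt_eqF ?implybT.
have mm' : m w `^ (- p^-1) * m w = m w `^ q.
  have -> : q = - p^-1 + 1 by rewrite /q addrC.
  by rewrite powRD ?powRr1 ?(ltW (m_gt0 w))// (gt_eqF (m_gt0 w)) implybT.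
have -> : s `^ p * A w = p^-1 * (s `^ p * s `^ (1 - p)) * (k w * m w `^ q).
  by rewrite /A /c1; ring.
rewrite ss -mm'.
have -> : s * (k w * (m w `^ (- p^-1) * m w)) =
    p^-1 * s * (k w * (m w `^ (- p^-1) * m w)) + B w * m w.
  by rewrite /B /c2 /q; ring.
rewrite lerD2l ler_wpM2l//; first by case/andP: (B0M w).
by rewrite /m lerDl ltW.
Qed.

Variables (lambda M : R) (g G b bh b' : T -> R).
Hypotheses (lambda0 : 0 < lambda) (mg : measurable_fun setT g).
Hypotheses (mb : measurable_fun setT b) (aG : adapted C G).
Hypotheses (ab' : adapted C b') (abh : adapted C bh).
Hypotheses (GM : forall w, `|G w| <= M) (b'_ge : forall w, lambda <= b' w).
Hypotheses (b'b : forall w, b' w <= b w) (bb' : forall w, b w <= b' w + `|g w|).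
Hypotheses (gb : forall w, `|g w| <= b w) (b'bh : forall w, b' w <= bh w).
Hypothesis Gbh : forall w, `|G w| <= bh w.
Hypotheses (xiE : xi = fun w => g w - G w) (psiE : psi = fun w => `|g w| / b w).
Hypothesis xi_null : null_on P C xi.

(** The predictable coefficients of each regime turn the pointwise lower bounds
    into means by taking out what is known; this is why any denominator [bh]
    known from the past that dominates [b'] and [`|G|] is allowed. *)
Lemma one_step :
  mean P (fun w => G w ^+ 2 / bh w) <=
  4 * mean P (fun w => G w * g w / b w) +
  32 * (sigma * mean P (fun w => ((G w / bh w) ^+ 2 + m w) `^ (q + 2^-1))).
Proof.
have /andP[q0 q1] := q01.
have b'0 w : 0 < b' w by exact: lt_le_trans (b'_ge w).
have b0 w : 0 < b w by exact: lt_le_trans (b'b w).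
have bh0 w : 0 < bh w by exact: lt_le_trans (b'bh w).
have b'0' w : 0 <= b' w by exact: ltW.
have b0' w : 0 <= b w by exact: ltW.
have bh0' w : 0 <= bh w by exact: ltW.
have M0 : 0 <= M by exact: le_trans (GM point).
pose r w := Num.sqrt (m w).
pose h w := sigma * m w `^ q.
have h0 w : 0 <= h w by rewrite mulr_ge0 ?powR_ge0.
have r0 w : 0 < r w by rewrite sqrtr_gt0.
(* On each regime, the predictable coefficients of the pointwise lower bound
   [al + be * xi - ka * (`|xi| * psi) - ta * psi ^+ 2] of the progress. *)
pose al w := if 4^-1 < Y w then 0 else if 4 * h w < `|G w| then 3 / 4 * (G w ^+ 2 / b' w)
  else - (`|G w| * r w / 2).
pose be w := if 4^-1 < Y w then 0 else if 4 * h w < `|G w| then G w / b' w else 0.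
pose ka w := if 4^-1 < Y w then 2 else if 4 * h w < `|G w| then `|G w| / b' w else 0.
pose ta w := if 4^-1 < Y w then - `|G w| else if 4 * h w < `|G w| then G w ^+ 2 / b' w
  else `|G w| / (2 * r w).
have ar : adapted C r by move: am; rewrite /adapted /r => *; measurability.
have ah : adapted C h by move: am; rewrite /adapted /h => *; measurability.
have r20 w : 0 <= 2 * r w by rewrite mulr_ge0// ltW.
have aal : adapted C al by move: aY aG ah ar ab'; rewrite /adapted /al => *; measurability.
have abe : adapted C be by move: aY aG ah ab'; rewrite /adapted /be => *; measurability.
have aka : adapted C ka by move: aY aG ah ab'; rewrite /adapted /ka => *; measurability.
have ata : adapted C ta by move: aY aG ah ar ab'; rewrite /adapted /ta => *; measurability.
have GM' w : G w ^+ 2 / b' w <= M ^+ 2 / lambda.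
  apply: ler_pM; rewrite ?sqr_ge0 ?invr_ge0//; last by rewrite lef_pV2 ?posrE.
  by rewrite -(real_normK (num_real (G w))) lerXn2r ?nnegrE.
have GM1 w : `|G w| / b' w <= M / lambda.
  by apply: ler_pM; rewrite ?invr_ge0// lef_pV2 ?posrE.
have rle w : r w <= Num.sqrt (1 + delta) by rewrite ler_wsqrtr.
have rge w : Num.sqrt delta <= r w by rewrite ler_wsqrtr.
have sd0 : 0 < Num.sqrt delta by rewrite sqrtr_gt0.
have s10 : 0 <= Num.sqrt (1 + delta) by exact: sqrtr_ge0.
have GM2 w : `|G w| / (2 * r w) <= M / (2 * Num.sqrt delta).
  apply: ler_pM; rewrite ?invr_ge0// lef_pV2 ?posrE ?mulr_gt0//.
  by rewrite ler_wpM2l.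
have Gb0 w : 0 <= G w ^+ 2 / b' w by rewrite divr_ge0 ?sqr_ge0.
have G1b0 w : 0 <= `|G w| / b' w by rewrite divr_ge0.
have G2b0 w : 0 <= `|G w| / (2 * r w) by rewrite divr_ge0.
have Grle w : 0 <= `|G w| * r w <= M * Num.sqrt (1 + delta).
  by rewrite mulr_ge0 ?(ltW (r0 w))//= ler_pM ?(ltW (r0 w)).
have ML0 : 0 <= M / lambda by rewrite divr_ge0// ltW.
have M2L0 : 0 <= M ^+ 2 / lambda by rewrite divr_ge0 ?sqr_ge0// ltW.
have M3L0 : 0 <= M / (2 * Num.sqrt delta) by rewrite divr_ge0// mulr_ge0// ltW.
have M4 : 0 <= M * Num.sqrt (1 + delta) by rewrite mulr_ge0.
have nal w : `|al w| <= M ^+ 2 / lambda + M * Num.sqrt (1 + delta).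
  rewrite /al; case: ifP => _; first by rewrite normr0 addr_ge0.
  have := GM' w; have := Gb0 w; have /andP[] := Grle w.
  by case: ifP => _ *; rewrite ler_norml; apply/andP; split; lra.
have nbe w : `|be w| <= M / lambda.
  rewrite /be; case: ifP => _; first by rewrite normr0.
  case: ifP => _; last by rewrite normr0.
  by rewrite normrM normfV (gtr0_norm (b'0 w)).
have nka w : 0 <= ka w <= 2 + M / lambda.
  rewrite /ka; case: ifP => _; first by apply/andP; split; lra.
  by have := GM1 w; have := G1b0 w; case: ifP => _ *; apply/andP; split; lra.
have nta w : `|ta w| <= M + M ^+ 2 / lambda + M / (2 * Num.sqrt delta).
  have := GM w; have := normr_ge0 (G w); have := GM' w; have := Gb0 w.
  have := GM2 w; have := G2b0 w.
  by rewrite /ta; case: ifP => _; last case: ifP => _; move=> *;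
    rewrite ler_norml; apply/andP; split; lra.
have mG := adapted_measurable sC aG; have mbh := adapted_measurable sC abh.
have mm := adapted_measurable sC am; have mxi := intg_measurable ixi.
have iF : intg P (fun w => G w * g w / b w).
  apply: (@intg_bounded _ _ _ _ _ M) => [|w]; first by measurability.
  rewrite normrM normfV (gtr0_norm (b0 w)) normrM -mulrA -[leRHS]mulr1.
  by apply: ler_pM => //; rewrite ?divr_ge0// ler_pdivrMr// mul1r.
have ipsi2 : intg P (fun w => psi w ^+ 2).
  apply: (@intg_bounded _ _ _ _ _ 1) => [|w]; first by measurability.
  by have /andP[? ?] := psi01 w; rewrite ger0_norm ?sqr_ge0// exprn_ile1.
have iY : intg P Y.
  apply: (@intg_bounded _ _ _ _ _ 1) => [|w]; first exact: adapted_measurable aY.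
  by rewrite ger0_norm; case/andP: (Y01 w).
have ixipsi : intg P (fun w => `|xi w| * psi w).
  apply: (@intg_dominated _ _ _ _ _ (fun w => `|xi w|)) => [|w|]; first by measurability.
  - have /andP[? ?] := psi01 w.
    by rewrite normrM normr_id (ger0_norm (x := psi w))// ler_piMr.
  - exact: intg_norm.
have mal := adapted_measurable sC aal; have mbe := adapted_measurable sC abe.
have mka := adapted_measurable sC aka; have mta := adapted_measurable sC ata.
have mh := adapted_measurable sC ah.
have ial := intg_bounded P mal nal.
have ibe := intgM_bounded mbe nbe ixi.
have nka' w : `|ka w| <= 2 + M / lambda by rewrite ger0_norm; case/andP: (nka w).
have ika := intgM_bounded mka nka' ixipsi.
have ita := intgM_bounded mta nta ipsi2.
have itaY := intgM_bounded mta nta iY.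
have ih : intg P h.
  apply: (@intg_bounded _ _ _ _ _ (sigma * (1 + delta) `^ q)) => // w.
  by rewrite ger0_norm// ler_wpM2l// mq_le// ltW.
have ikh := intgM_bounded mka nka' ih.
have pw1 w : al w + be w * xi w - ka w * (`|xi w| * psi w) - ta w * psi w ^+ 2 <=
    G w * g w / b w.
  rewrite xiE psiE /al /be /ka /ta; case: ifP => _.
    by have := step_large_psi (G w) (b0 w) (gb w); lra.
  case: ifP => _; first by have := step_small_psi (G w) (b'0 w) (b'b w) (bb' w); lra.
  by have := step_any_psi (G w) (g w) (b0 w) (r0 w); lra.
have m1 : mean P al - mean P (fun w => ka w * h w) - mean P (fun w => ta w * Y w) <=
    mean P (fun w => G w * g w / b w).
  have i1 := intgD ial ibe; have i2 := intgB i1 ika; have i3 := intgB i2 ita.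
  apply: le_trans (mean_le i3 iF pw1).
  rewrite (meanB i2 ita) (meanB i1 ika) (meanD ial ibe).
  rewrite (null_on_mul sC xi_null abe nbe) addr0.
  rewrite (null_on_eq sC ipsi2 iY psiY ata nta) lerD2r lerD2l lerN2.
  exact: noise_correlation aka nka.
pose n w := (G w / bh w) ^+ 2 + m w.
have iGb : intg P (fun w => G w ^+ 2 / bh w).
  apply: (@intg_bounded _ _ _ _ _ M) => [|w]; first by measurability.
  rewrite ger0_norm ?divr_ge0 ?sqr_ge0// -(real_normK (num_real (G w))) expr2 -mulrA.
  rewrite -[leRHS]mulr1; apply: ler_pM => //; rewrite ?divr_ge0//.
  by rewrite ler_pdivrMr// mul1r.
have n0 w : 0 < n w by rewrite ltr_wpDl ?sqr_ge0.
have nle w : n w <= 2 + delta.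
  have -> : 2 + delta = 1 + (1 + delta) by ring.
  rewrite lerD// -(real_normK (num_real (G w / bh w))) exprn_ile1//.
  by rewrite normrM normfV (gtr0_norm (bh0 w)) ler_pdivrMr// mul1r.
have inq : intg P (fun w => n w `^ (q + 2^-1)).
  apply: (@intg_bounded _ _ _ _ _ ((2 + delta) `^ (q + 2^-1))) => [|w].
    by rewrite /n; measurability.
  rewrite ger0_norm ?powR_ge0//; apply: ge0_ler_powR; rewrite ?nnegrE ?(ltW (n0 w))//.
    by move: q0; lra.
  by move: delta0; lra.
have pw2 w : 4^-1 * (G w ^+ 2 / bh w) - 8 * (sigma * n w `^ (q + 2^-1)) <=
    al w - ka w * h w - ta w * Y w.
  have /andP[Y0 Y1] := Y01 w.
  have Yr : Y w <= r w ^+ 2 by rewrite sqr_sqrtr ?(ltW (m_gt0 w))// /m lerDl ltW.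
  apply: le_trans (step_regimes (b'0 w) (b'bh w) (Gbh w) (h0 w) (r0 w) Y0 Yr).
  have := correlation_product (G w) sigma0 (m_gt0 w) (ltW q0) (bh0 w).
  by rewrite -/(h w) -/(r w) -/(n w); lra.
have i1 := intgB ial ikh.
have i2 := intgZ (4^-1) iGb; have i3 := intgZ 8 (intgZ sigma inq).
have := mean_le (intgB i2 i3) (intgB i1 itaY) pw2.
rewrite (meanB i2 i3) (meanB i1 itaY) (meanB ial ikh) !meanZ//; last exact: intgZ.
by move=> m2; have := le_trans m2 m1; rewrite -/n; lra.
Qed.

End OneStep.

(** * A whole trajectory in one coordinate *)

Section Coordinate.
Context d (T : measurableType d) (R : realType) (P : probability T R).
Variable C : nat -> set (set T).
Hypothesis sC : forall t, <<s C t>> `<=` measurable.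
Hypothesis monoC : forall s t, (s <= t)%N -> C s `<=` C t.
Variables (p sigma lambda M K : R) (g G : nat -> T -> R) (n : nat).
Hypotheses (p12 : 1 < p <= 2) (sigma0 : 0 <= sigma) (lambda0 : 0 < lambda).
Hypothesis n0 : (0 < n)%N.
Hypothesis ag : forall s t, (1 <= s <= t)%N -> adapted (C t) (g s).
Hypothesis cG : forall t, (1 <= t)%N ->
  is_cond_expectation P <<s C t.-1>> (g t) (G t).
Hypothesis moment : forall t, (1 <= t)%N ->
  cond_expectation_le P <<s C t.-1>> (fun w => `|g t w - G t w| `^ p) (sigma `^ p).
Hypothesis M0 : 0 <= M.
Hypothesis GM : forall w, \sum_(1 <= s < n.+1) G s w ^+ 2 <= M ^+ 2.
Hypothesis K1 : 1 < K.
Hypothesis K_ge : lambda + 2 * M + Num.sqrt 2 * sigma * n%:R `^ p^-1 <= lambda * K.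

Let b t w := lambda + Num.sqrt (\sum_(1 <= s < t.+1) g s w ^+ 2).
Let S t w := Num.sqrt (\sum_(1 <= s < t.+1) G s w ^+ 2).
Let bh t w := b t.-1 w + S t w.
Let psi t w := `|g t w| / b t w.
Let xi t w := g t w - G t w.
Let D w := \sum_(1 <= t < n.+1) G t w ^+ 2 / bh t w.

Let p0 : 0 < p. Proof. by case/andP: p12; lra. Qed.
Let lnK : 0 < ln K. Proof. exact: ln_gt0. Qed.
Let nR : 0 < n%:R :> R. Proof. by rewrite ltr0n. Qed.

Let adapted_le s t (Z : T -> R) : (s <= t)%N -> adapted (C s) Z -> adapted (C t) Z.
Proof.
move=> st aZ mT B mB.
exact: (@sub_sigma_algebra2 _ _ _ _ (@monoC _ _ st)) (aZ measurableT B mB).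
Qed.

Let aG s t : (1 <= s)%N -> (s.-1 <= t)%N -> adapted (C t) (G s).
Proof.
move=> s1 st; apply: adapted_le st _; have [_ _ mG _] := cG s1.
by move=> _ B mB; rewrite setTI; exact: mG.
Qed.

Let mg t : (1 <= t)%N -> measurable_fun setT (g t).
Proof. by move=> t1; apply: (adapted_measurable (@sC t)); apply: ag; rewrite t1 /=. Qed.

Let mG t : (1 <= t)%N -> measurable_fun setT (G t).
Proof. by move=> t1; apply: (adapted_measurable (@sC t.-1)); exact: aG. Qed.

Let measurable_big (d' : measure_display) (T' : measurableType d') (F : nat -> T' -> R) m :
  (forall s, (1 <= s < m)%N -> measurable_fun setT (F s)) ->
  measurable_fun setT (fun w => \sum_(1 <= s < m) F s w).
Proof.
move=> H; rewrite (_ : (fun w => _) =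
    (fun w => \sum_(1 <= s < m) (if (1 <= s < m)%N then F s w else 0))).
  apply: measurable_sum => s.
  by case: (boolP (1 <= s < m)%N) => [/H//|_]; exact: measurable_cst.
by apply/funext => w; rewrite !big_nat; apply: eq_bigr => s ->.
Qed.

Let ab t : adapted (C t) (b t).
Proof.
have H : adapted (C t) (fun w => \sum_(1 <= s < t.+1) g s w ^+ 2).
  by apply: measurable_big => s st; apply: measurable_funX; exact: ag.
by rewrite /adapted /b; move: H; rewrite /adapted => H; measurability.
Qed.

Let aS t : adapted (C t.-1) (S t).
Proof.
apply: measurable_sqrt_comp; apply: measurable_big => s /andP[s1 st].
by apply: measurable_funX; apply: aG => //; rewrite -!subn1 leq_sub2r.
Qed.

Let abh t : adapted (C t.-1) (bh t).
Proof. by apply: measurable_add_comp; [exact: ab|exact: aS]. Qed.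

Let b_ge t w : lambda <= b t w. Proof. by rewrite lerDl sqrtr_ge0. Qed.
Let b_gt0 t w : 0 < b t w. Proof. exact: lt_le_trans (b_ge t w). Qed.
Let S_ge0 t w : 0 <= S t w. Proof. exact: sqrtr_ge0. Qed.
Let sum_sqr_ge0 (u : nat -> T -> R) t w : 0 <= \sum_(1 <= s < t.+1) u s w ^+ 2.
Proof. by apply: sumr_ge0 => s _; exact: sqr_ge0. Qed.
Let bh_gt0 t w : 0 < bh t w. Proof. by rewrite ltr_wpDr. Qed.

Let sumS (u : nat -> R) t : (1 <= t)%N ->
  \sum_(1 <= s < t.+1) u s = \sum_(1 <= s < t.-1.+1) u s + u t.
Proof. by case: t => // t _; rewrite big_nat_recr. Qed.

Let b_mono t w : (1 <= t)%N -> b t.-1 w <= b t w.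
Proof.
move=> t1; rewrite lerD2l ler_wsqrtr// (sumS (fun s => g s w ^+ 2) t1) lerDl.
exact: sqr_ge0.
Qed.

Let b_step t w : (1 <= t)%N -> b t w <= b t.-1 w + `|g t w|.
Proof.
move=> t1; rewrite /b -addrA lerD2l (sumS (fun s => g s w ^+ 2) t1).
by rewrite -[`|g t w|]sqrtr_sqr sqrtrD_le ?sqr_ge0.
Qed.

Let g_le t w : (1 <= t)%N -> `|g t w| <= b t w.
Proof.
move=> t1; rewrite -[`|g t w|]sqrtr_sqr.
apply: (@le_trans _ _ (Num.sqrt (\sum_(1 <= s < t.+1) g s w ^+ 2))).
  by rewrite ler_wsqrtr// (sumS (fun s => g s w ^+ 2) t1) lerDr.
by rewrite lerDr ltW.
Qed.

Let G_le t w : (1 <= t)%N -> `|G t w| <= S t w.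
Proof.
by move=> t1; rewrite -[`|G t w|]sqrtr_sqr ler_wsqrtr// (sumS (fun s => G s w ^+ 2) t1) lerDr.
Qed.

Let S_mono s t w : (s <= t)%N -> S s w <= S t w.
Proof.
move=> st; rewrite ler_wsqrtr// (@big_cat_nat _ _ _ s.+1 1 t.+1)//=.
by rewrite lerDl sumr_ge0// => i _; exact: sqr_ge0.
Qed.

Let S_leM w : S n w <= M.
Proof. by rewrite -[M]ger0_norm// -sqrtr_sqr ler_wsqrtr. Qed.

Let GleM t w : (1 <= t <= n)%N -> `|G t w| <= M.
Proof.
by move=> /andP[t1 tn]; apply: le_trans (G_le w t1) (le_trans (S_mono w tn) (S_leM w)).
Qed.

Let psi01 t w : (1 <= t)%N -> 0 <= psi t w <= 1.
Proof.
by move=> t1; rewrite divr_ge0 ?(ltW (b_gt0 t w))//= ler_pdivrMr// mul1r g_le.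
Qed.

Let mb t : measurable_fun setT (b t).
Proof. exact: (adapted_measurable (@sC t) (@ab t)). Qed.

Let mpsi t : (1 <= t)%N -> measurable_fun setT (psi t).
Proof.
move=> t1; apply: measurable_div_comp => //; last by move=> w; rewrite ltW.
by apply: measurable_norm_comp; exact: mg.
Qed.

Let ixi t : (1 <= t)%N -> intg P (xi t).
Proof. by move=> t1; have [ig iG _ _] := cG t1; exact: intgB. Qed.

Let mean_xi_p t : (1 <= t)%N ->
  intg P (fun w => `|xi t w| `^ p) /\ mean P (fun w => `|xi t w| `^ p) <= sigma `^ p.
Proof.
move=> t1; have [V [iX _ _ _] _] := moment t1; split; first exact: iX.
have := @cond_expectation_le_mul _ _ _ P (C t.-1) (@sC t.-1) _ _ (fun=> 1) 1 (moment t1).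
rewrite mean_cst mulr1; under eq_mean do rewrite mul1r.
by apply; [exact: measurable_cst|move=> w; rewrite ler01 lexx].
Qed.

Let mS : measurable_fun setT (S n).
Proof. exact: (adapted_measurable (@sC n.-1) (@aS n)). Qed.

Let iS : intg P (S n).
Proof. by apply: (@intg_bounded _ _ _ _ _ M) => // w; rewrite ger0_norm// S_leM. Qed.

Let N w := Num.sqrt (\sum_(1 <= t < n.+1) xi t w ^+ 2).

Let mN : measurable_fun setT N.
Proof.
apply: measurable_sqrt_comp; apply: measurable_big => s /andP[s1 _].
by apply: measurable_funX; exact: intg_measurable (ixi s1).
Qed.

(** The total noise grows like [n `^ (1/p)] only, by Jensen's inequality for the
    concave power [1/p]; the tangent at a level [s > sigma] covers [sigma = 0]. *)
Lemma mean_noise : intg P N /\ mean P N <= sigma * n%:R `^ p^-1.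
Proof.
have iA t : (1 <= t < n.+1)%N -> intg P (fun w => `|xi t w| `^ p).
  by move=> /andP[t1 _]; case: (mean_xi_p t1).
have [iSum eSum] := intg_sum_nat iA.
have sumle : mean P (fun w => \sum_(1 <= t < n.+1) `|xi t w| `^ p) <= n%:R * sigma `^ p.
  rewrite eSum; apply: (@le_trans _ _ (\sum_(1 <= t < n.+1) sigma `^ p)).
    by rewrite !big_nat; apply: ler_sum => t /andP[t1 _]; case: (mean_xi_p t1).
  by rewrite sumr_const_nat subn1 mulr_natl.
have N0 w : 0 <= N w by exact: sqrtr_ge0.
have bound s w := sqrt_sum_sqr_le_tangent (xi ^~ w) n p12 (s := s).
pose maj s w := s * (1 - p^-1 + p^-1 * ((\sum_(1 <= t < n.+1) `|xi t w| `^ p) / s `^ p)).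
have imaj s : intg P (maj s).
  apply: intgZ; apply: intgD; first exact: intg_cst.
  by apply: intgZ; under eq_fun do rewrite mulrC; exact: intgZ.
have iN : intg P N.
  apply: (intg_dominated mN _ (imaj 1)) => w; rewrite ger0_norm//.
  exact: bound.
split => //; apply/ler_addgt0Pr => e e0.
have nb0 : 0 < n%:R `^ p^-1 :> R by rewrite powR_gt0.
(* The error [e] is shared out so that [s] exceeds the claimed bound by [e]. *)
pose s := (sigma + e / n%:R `^ p^-1) * n%:R `^ p^-1.
have s0 : 0 < s by rewrite mulr_gt0// ltr_wpDl// divr_gt0.
have -> : sigma * n%:R `^ p^-1 + e = s.
  by rewrite /s mulrDl divfK// gt_eqF.
apply: le_trans (mean_le iN (imaj s) (fun w => bound s w s0)) _.
have i1 : intg P (fun w => (\sum_(1 <= t < n.+1) `|xi t w| `^ p) / s `^ p).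
  by under eq_fun do rewrite mulrC; exact: intgZ.
rewrite /maj meanZ; last by apply: intgD; [exact: intg_cst|exact: intgZ].
rewrite (meanD (intg_cst P _) (intgZ _ i1)) mean_cst meanZ//.
under [X in p^-1 * mean P X]eq_fun do rewrite mulrC.
rewrite meanZ// -[leRHS]mulr1; apply: ler_wpM2l; first exact: ltW.
have spp : 0 < s `^ p by rewrite powR_gt0.
have sE : n%:R * sigma `^ p <= s `^ p.
  have sn0 : 0 < sigma + e / n%:R `^ p^-1 by rewrite ltr_wpDl// divr_gt0.
  rewrite /s powRM ?(ltW sn0) ?(ltW nb0)// -powRrM mulVf ?gt_eqF//.
  rewrite powRr1 ?(ltW nR)// mulrC ler_wpM2r ?(ltW nR)//.
  apply: ge0_ler_powR; rewrite ?nnegrE ?(ltW p0)//.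
    by rewrite addr_ge0// divr_ge0// ltW.
  by rewrite lerDl divr_ge0// ltW.
have : (s `^ p)^-1 * mean P (fun w => \sum_(1 <= t < n.+1) `|xi t w| `^ p) <= 1.
  by rewrite mulrC ler_pdivrMr// mul1r (le_trans sumle).
have : 0 <= p^-1 by rewrite invr_ge0 ltW.
nra.
Qed.

Let v_le w : Num.sqrt (\sum_(1 <= s < n.+1) g s w ^+ 2) <=
  Num.sqrt 2 * S n w + Num.sqrt 2 * N w.
Proof.
rewrite /S /N -!sqrtrM//; apply: le_trans (sqrtrD_le _ _).
- rewrite ler_wsqrtr// !mulr_sumr -big_split/=; apply: ler_sum => s _.
  by rewrite /xi; have := sqr_ge0 (g s w - 2 * G s w); nra.
- by rewrite mulr_ge0.
- by rewrite mulr_ge0// sumr_ge0// => s _; exact: sqr_ge0.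
Qed.

Let sqrt2_le : Num.sqrt 2 <= 2 :> R.
Proof.
by rewrite -[leRHS]ger0_norm// -sqrtr_sqr ler_wsqrtr//; lra.
Qed.

Lemma intg_psi_sqr t : (1 <= t)%N -> intg P (fun w => psi t w ^+ 2).
Proof.
move=> t1; apply: (@intg_bounded _ _ _ _ _ 1) => [|w].
  by apply: measurable_funX; exact: mpsi.
by have /andP[? ?] := psi01 w t1; rewrite ger0_norm ?sqr_ge0// exprn_ile1.
Qed.

(** The squares telescope through the logarithm of the denominator, and the
    tangent of [ln] at [lambda * K] replaces the final denominator by its
    mean. *)
Lemma mean_sum_psi_sqr :
  \sum_(1 <= t < n.+1) mean P (fun w => psi t w ^+ 2) <= 2 * ln K.
Proof.
have ipsi t : (1 <= t < n.+1)%N -> intg P (fun w => psi t w ^+ 2).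
  by move=> /andP[t1 _]; exact: intg_psi_sqr.
have [i e] := intg_sum_nat ipsi.
have [iN eN] := mean_noise.
have K0 : 0 < K by exact: lt_trans K1.
pose maj w := 2 * (ln K + (lambda + Num.sqrt 2 * S n w + Num.sqrt 2 * N w
  - lambda * K) / (lambda * K)).
have i1 : intg P (fun w => lambda + Num.sqrt 2 * S n w + Num.sqrt 2 * N w).
  apply: intgD; last exact: intgZ.
  by apply: intgD; [exact: intg_cst|exact: intgZ].
have i2 : intg P (fun w => lambda + Num.sqrt 2 * S n w + Num.sqrt 2 * N w
  - lambda * K) by apply: intgB => //; exact: intg_cst.
have i3 : intg P (fun w => (lambda + Num.sqrt 2 * S n w + Num.sqrt 2 * N w
  - lambda * K) / (lambda * K)) by under eq_fun do rewrite mulrC; exact: intgZ.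
have imaj : intg P maj by apply: intgZ; apply: intgD => //; exact: intg_cst.
have lK0 : 0 < lambda * K by rewrite mulr_gt0.
rewrite -e; apply: (@le_trans _ _ (mean P maj)).
  apply: mean_le => // w.
  have -> : \sum_(1 <= t < n.+1) psi t w ^+ 2 = \sum_(1 <= t < n.+1)
      g t w ^+ 2 / (lambda + Num.sqrt (\sum_(1 <= s < t.+1) g s w ^+ 2)) ^+ 2.
    by apply: eq_bigr => t _; rewrite /psi expr_div_n real_normK ?num_real.
  apply: le_trans (log_increment_sum (g ^~ w) n lambda0) _; apply: ler_wpM2l => //.
  have := ln_le_tangent lK0 (b_gt0 n w); rewrite lnM ?posrE// => h.
  rewrite lerBlDr; apply: (le_trans h).
  rewrite [leRHS]addrC [leRHS]addrA lerD2l.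
  rewrite ler_wpM2r ?invr_ge0 ?(ltW lK0)// lerD2r /b -addrA lerD2l.
  exact: v_le.
rewrite /maj meanZ; last by apply: intgD => //; exact: intg_cst.
rewrite (meanD (intg_cst P _) i3) mean_cst; apply: ler_wpM2l => //.
under [X in _ + mean P X]eq_fun do rewrite mulrC.
rewrite meanZ// (meanB i1 (intg_cst P _)) mean_cst.
rewrite (meanD (intgD (intg_cst P _) (intgZ _ iS)) (intgZ _ iN)).
rewrite (meanD (intg_cst P _) (intgZ _ iS)) mean_cst !meanZ//.
have mSM : mean P (S n) <= M.
  by rewrite -[leRHS](mean_cst P); apply: mean_le => //; exact: intg_cst.
have mS0 : 0 <= mean P (S n) by exact: mean_ge0.
have s20 : 0 <= Num.sqrt 2 :> R by exact: sqrtr_ge0.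
have h1 : Num.sqrt 2 * mean P (S n) <= 2 * M by exact: (ler_pM s20 mS0 sqrt2_le mSM).
have h2 := ler_wpM2l s20 eN.
rewrite gerDl pmulr_rle0 ?invr_gt0//.
by move: h1 h2 K_ge; rewrite -[Num.sqrt 2 * sigma * _]mulrA; lra.
Qed.

(** Keeping the past gradients in the surrogate denominator [bh] makes the
    analogous sum for the true gradients bounded pointwise. *)
Lemma sum_G_sqr w : \sum_(1 <= t < n.+1) (G t w / bh t w) ^+ 2 <= 2 * ln K.
Proof.
have K0 : 0 < K by exact: lt_trans K1.
apply: (@le_trans _ _ (\sum_(1 <= t < n.+1) G t w ^+ 2 / (lambda + S t w) ^+ 2)).
  apply: ler_sum => t _; rewrite expr_div_n ler_wpM2l ?sqr_ge0//.
  have l0 : 0 < lambda + S t w by rewrite ltr_wpDr.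
  rewrite lef_pV2 ?posrE ?exprn_gt0// lerXn2r ?nnegrE ?(ltW l0) ?(ltW (bh_gt0 t w))//.
  by rewrite lerD2r.
apply: le_trans (log_increment_sum (G ^~ w) n lambda0) _; apply: ler_wpM2l => //.
rewrite lerBlDr -lnM ?posrE// ler_ln ?posrE ?mulr_gt0//; last by rewrite ltr_wpDr.
have h1 := S_leM w; rewrite /S in h1.
have : 0 <= Num.sqrt 2 * sigma * n%:R `^ p^-1 by rewrite !mulr_ge0 ?powR_ge0.
by move: K_ge M0; rewrite [K * _]mulrC; lra.
Qed.

Let alpha := 1 - p^-1 + 2^-1.

Let alpha01 : 0 < alpha <= 1.
Proof.
case/andP: p12 => p1 p2; have h1 : p^-1 < 1 by rewrite invf_lt1.
have h2 : 2^-1 <= p^-1 by rewrite lef_pV2 ?posrE.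
by rewrite /alpha; lra.
Qed.

Lemma intg_progress t : (1 <= t <= n)%N -> intg P (fun w => G t w * g t w / b t w).
Proof.
move=> tn; have /andP[t1 _] := tn; apply: (@intg_bounded _ _ _ _ _ M) => [|w].
  apply: measurable_div_comp => //; last by move=> w; rewrite ltW.
  by apply: measurable_mul_comp; [exact: mG|exact: mg].
rewrite normrM normfV (gtr0_norm (b_gt0 t w)) normrM -mulrA -[leRHS]mulr1.
have /andP[? ?] := psi01 w t1.
by apply: ler_pM => //; exact: GleM.
Qed.

Let bh_ge t w : (1 <= t)%N -> `|G t w| <= bh t w.
Proof. by move=> t1; apply: le_trans (G_le w t1) _; rewrite lerDr ltW. Qed.

Let iGbh t : (1 <= t <= n)%N -> intg P (fun w => G t w ^+ 2 / bh t w).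
Proof.
move=> tn; have /andP[t1 _] := tn; apply: (@intg_bounded _ _ _ _ _ M) => [|w].
  apply: measurable_div_comp; last by move=> w; rewrite ltW.
    by apply: measurable_funX; exact: mG.
  exact: (adapted_measurable (@sC t.-1) (@abh t)).
rewrite ger0_norm ?divr_ge0 ?sqr_ge0 ?(ltW (bh_gt0 t w))//.
rewrite -(real_normK (num_real (G t w))) expr2 -mulrA -[leRHS]mulr1.
apply: ler_pM => //; [by rewrite divr_ge0// ltW|exact: GleM|].
by rewrite ler_pdivrMr// mul1r bh_ge.
Qed.

Let iGbh2 t : (1 <= t <= n)%N -> intg P (fun w => (G t w / bh t w) ^+ 2).
Proof.
move=> tn; have /andP[t1 _] := tn; apply: (@intg_bounded _ _ _ _ _ 1) => [|w].
  apply: measurable_funX; apply: measurable_div_comp; last by move=> w; rewrite ltW.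
    exact: mG.
  exact: (adapted_measurable (@sC t.-1) (@abh t)).
rewrite ger0_norm ?sqr_ge0// -(real_normK (num_real (G t w / _))) exprn_ile1//.
by rewrite normrM normfV (gtr0_norm (bh_gt0 t w)) ler_pdivrMr// mul1r bh_ge.
Qed.

Let mean_step s t : 0 < s -> (1 <= t <= n)%N ->
  mean P (fun w => G t w ^+ 2 / bh t w) <=
  4 * mean P (fun w => G t w * g t w / b t w) +
  32 * (sigma * (s `^ alpha * (1 - alpha + alpha / s *
    (mean P (fun w => (G t w / bh t w) ^+ 2) + mean P (fun w => psi t w ^+ 2)
     + ln K / n%:R)))).
Proof.
move=> s0 tn; have /andP[t1 tn'] := tn.
have mp2 : measurable_fun setT (fun w => psi t w ^+ 2).
  by apply: measurable_funX; exact: mpsi.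
have p201 w : 0 <= psi t w ^+ 2 <= 1.
  by have /andP[? ?] := psi01 w t1; rewrite sqr_ge0 exprn_ile1.
have [Y [aY Y01 nY]] := cond_mean_exists P (@sC t.-1) mp2 p201.
pose delta := ln K / n%:R.
have delta0 : 0 < delta by rewrite divr_gt0.
have := @one_step _ _ _ P (C t.-1) (@sC t.-1) p sigma delta (xi t) (psi t) Y p12 sigma0
  delta0 (ixi t1) (mpsi t1) (fun w => psi01 w t1) aY Y01 nY (moment t1)
  lambda M (g t) (G t) (b t) (bh t) (b t.-1) lambda0 (mg t1) (@mb t) (aG t1 (leqnn _))
  (@ab t.-1) (@abh t) (fun w => GleM w tn) (b_ge t.-1) (fun w => b_mono w t1)
  (fun w => b_step w t1) (fun w => g_le w t1).
have bbh w : b t.-1 w <= bh t w by rewrite lerDl.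
move=> /(_ bbh (fun w => bh_ge w t1) erefl erefl).
move=> /(_ (is_cond_expectation_null_on (@sC t.-1) (cG t1))).
move=> /le_trans; apply; rewrite lerD2l; apply: ler_wpM2l => //; apply: ler_wpM2l => //.
rewrite -/alpha -/delta.
have iY : intg P Y.
  apply: (@intg_bounded _ _ _ _ _ 1) => [|w]; first exact: (adapted_measurable (@sC t.-1) aY).
  by rewrite ger0_norm; case/andP: (Y01 w).
have ip2 : intg P (fun w => psi t w ^+ 2).
  by apply: (@intg_bounded _ _ _ _ _ 1) => // w; rewrite ger0_norm; case/andP: (p201 w).
have eY : mean P (fun w => psi t w ^+ 2) = mean P Y.
  have a1 : adapted (C t.-1) (fun=> 1 : R) by exact: measurable_cst.
  have b1 (w : T) : `|1 : R| <= 1 by rewrite normr1.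
  have := null_on_eq (@sC t.-1) ip2 iY nY a1 b1.
  by under eq_mean do rewrite mul1r; under [RHS]eq_mean do rewrite mul1r.
have i2 := iGbh2 tn.
have i3 : intg P (fun w => (G t w / bh t w) ^+ 2 + (Y w + delta)).
  by apply: intgD => //; apply: intgD => //; exact: intg_cst.
have i4 : intg P (fun w => s `^ alpha * (1 - alpha + alpha / s *
    ((G t w / bh t w) ^+ 2 + (Y w + delta)))).
  by apply: intgZ; apply: intgD; [exact: intg_cst|exact: intgZ].
have -> : s `^ alpha * (1 - alpha + alpha / s *
    (mean P (fun w => (G t w / bh t w) ^+ 2) + mean P (fun w => psi t w ^+ 2) + delta)) =
   mean P (fun w => s `^ alpha * (1 - alpha + alpha / s *
    ((G t w / bh t w) ^+ 2 + (Y w + delta)))).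
  rewrite meanZ; last by apply: intgD; [exact: intg_cst|exact: intgZ].
  rewrite (meanD (intg_cst P _) (intgZ _ i3)) mean_cst meanZ//.
  rewrite (meanD i2 (intgD iY (intg_cst P _))) (meanD iY (intg_cst P _)) mean_cst.
  by rewrite eY; ring.
have pw w : ((G t w / bh t w) ^+ 2 + (Y w + delta)) `^ alpha <=
  s `^ alpha * (1 - alpha + alpha / s * ((G t w / bh t w) ^+ 2 + (Y w + delta))).
  have x0 : 0 <= (G t w / bh t w) ^+ 2 + (Y w + delta).
    rewrite addr_ge0 ?sqr_ge0// addr_ge0 ?(ltW delta0)//.
    by case/andP: (Y01 w).
  have := powR_le_tangent alpha01 s0 x0; move/le_trans; apply.
  by rewrite le_eqVlt; apply/orP; left; apply/eqP; ring.
apply: mean_le => //; apply: (intg_dominated _ _ i4) => [|w].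
  apply: measurable_powR_comp; apply: measurable_add_comp.
    exact: intg_measurable i2.
  by apply: measurable_add_comp; [exact: intg_measurable iY|exact: measurable_cst].
by rewrite ger0_norm ?powR_ge0.
Qed.

Let mean_D : intg P D /\
  mean P D = \sum_(1 <= t < n.+1) mean P (fun w => G t w ^+ 2 / bh t w).
Proof. by apply: intg_sum_nat => t tn; exact: iGbh tn. Qed.

(** Summing the one-step bounds. Concavity of the power [alpha] is used through
    its tangent at the average [5 * ln K / n] of the quantities to be summed. *)
Lemma mean_D_le :
  mean P D <= 4 * \sum_(1 <= t < n.+1) mean P (fun w => G t w * g t w / b t w) +
    160 * (sigma * (ln K `^ (1 - p^-1 + 2^-1) * n%:R `^ (p^-1 - 2^-1))).
Proof.
have [_ ->] := mean_D.
pose s := 5 * ln K / n%:R.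
have s0 : 0 < s by rewrite divr_gt0// mulr_gt0.
pose x t := mean P (fun w => (G t w / bh t w) ^+ 2).
pose y t := mean P (fun w => psi t w ^+ 2).
have step : \sum_(1 <= t < n.+1) mean P (fun w => G t w ^+ 2 / bh t w) <=
  \sum_(1 <= t < n.+1) (4 * mean P (fun w => G t w * g t w / b t w) +
    32 * (sigma * (s `^ alpha * (1 - alpha + alpha / s * (x t + y t + ln K / n%:R))))).
  by rewrite !big_nat; apply: ler_sum => t tn; exact: mean_step.
apply: (le_trans step); rewrite big_split/= -mulr_sumr lerD2l.
rewrite -mulr_sumr -mulr_sumr -mulr_sumr.
have sx : \sum_(1 <= t < n.+1) x t <= 2 * ln K.
  have i0 t : (1 <= t < n.+1)%N -> intg P (fun w => (G t w / bh t w) ^+ 2).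
    exact: iGbh2.
  have [i <-] := intg_sum_nat i0.
  rewrite -[leRHS](mean_cst P); apply: mean_le => //; first exact: intg_cst.
  exact: sum_G_sqr.
have sy : \sum_(1 <= t < n.+1) y t <= 2 * ln K by exact: mean_sum_psi_sqr.
have nn0 : n%:R != 0 :> R by rewrite gt_eqF.
have tot : \sum_(1 <= t < n.+1) (1 - alpha + alpha / s * (x t + y t + ln K / n%:R)) <= n%:R.
  rewrite big_split/= -mulr_sumr !big_split/= !sumr_const_nat subn1/=.
  rewrite -[- alpha *+ n]mulr_natl -[(ln K / _) *+ n]mulr_natl.
  have -> : n%:R * (ln K / n%:R) = ln K by field.
  have as0 : 0 <= alpha / s by case/andP: alpha01 => a0 _; rewrite divr_ge0// ltW.
  have : alpha / s * (\sum_(1 <= t < n.+1) x t + \sum_(1 <= t < n.+1) y t + ln K) <=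
      alpha / s * (5 * ln K) by rewrite ler_wpM2l//; lra.
  have -> : alpha / s * (5 * ln K) = n%:R * alpha.
    by rewrite /s; field; rewrite nn0 gt_eqF.
  lra.
have [a0 a1] := andP alpha01.
have sa : s `^ alpha * n%:R <= 5 * (ln K `^ alpha * n%:R `^ (p^-1 - 2^-1)).
  have -> : s `^ alpha = 5 `^ alpha * ln K `^ alpha * (n%:R `^ alpha)^-1.
    rewrite /s !powRM ?invr_ge0 ?mulr_ge0 ?(ltW lnK) ?(ltW nR)//.
    by rewrite -[n%:R^-1]powR_inv1 ?(ltW nR)// -powRrM mulN1r powRN.
  have -> : p^-1 - 2^-1 = 1 - alpha by rewrite /alpha; lra.
  rewrite powRB ?(negbTE nn0) ?implybT// powRr1 ?(ltW nR)//.
  have h5 : 5 `^ alpha <= 5 :> R.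
    by rewrite -[leRHS]powRr1//; apply: ler_powR => //; lra.
  have -> : 5 `^ alpha * ln K `^ alpha / n%:R `^ alpha * n%:R =
    5 `^ alpha * (ln K `^ alpha * (n%:R / n%:R `^ alpha)) by ring.
  by rewrite ler_wpM2r// mulr_ge0 ?powR_ge0// divr_ge0 ?powR_ge0 ?(ltW nR).
have := le_trans (ler_wpM2l (powR_ge0 s alpha) tot) sa.
rewrite -/alpha => /(ler_wpM2l sigma0); lra.
Qed.

Let D_ge0 w : 0 <= D w.
Proof. by apply: sumr_ge0 => t _; rewrite divr_ge0 ?sqr_ge0// ltW. Qed.

Let S_sqr_le w : S n w ^+ 2 <= D w * (lambda + 3 * S n w + 2 * N w).
Proof.
set B := lambda + _ + _.
have N0 : 0 <= N w by exact: sqrtr_ge0.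
have B0 : 0 < B by have := S_ge0 n w; rewrite /B; move: lambda0; lra.
rewrite -ler_pdivrMr// /S sqr_sqrtr// mulr_suml /D !big_nat.
apply: ler_sum => t /andP[t1 tn]; rewrite ler_wpM2l ?sqr_ge0// lef_pV2 ?posrE//.
have bn : b t.-1 w <= lambda + 2 * S n w + 2 * N w.
  apply: (@le_trans _ _ (b n w)).
    rewrite lerD2l ler_wsqrtr// (@big_cat_nat _ _ _ t.-1.+1 1 n.+1)//=; last first.
      by rewrite prednK// ltnW.
    by rewrite lerDl sumr_ge0// => i _; exact: sqr_ge0.
  rewrite /b -addrA lerD2l; apply: (le_trans (v_le w)).
  by rewrite lerD// ler_wpM2r.
have := S_mono w (tn : (t <= n)%N); rewrite /bh /B; lra.
Qed.

(** [S ^+ 2] is at most [D] times the final surrogate denominator, which is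
    linear in [S] and in the noise; [self_bounding] solves this for [S]. The
    free parameter [s] is to be chosen once for all coordinates. *)
Lemma mean_sum_norm_G s : 0 < s ->
  intg P (fun w => \sum_(1 <= t < n.+1) `|G t w|) /\
  mean P (fun w => \sum_(1 <= t < n.+1) `|G t w|) <=
  Num.sqrt n%:R * (4 * mean P D + lambda + s * mean P D + sigma * n%:R `^ p^-1 / s).
Proof.
move=> s0; have [iD _] := mean_D; have [iN eN] := mean_noise.
have iG t : (1 <= t < n.+1)%N -> intg P (fun w => `|G t w|).
  by move=> /andP[t1 _]; have [_ i _ _] := cG t1; exact: intg_norm.
have [iSum _] := intg_sum_nat iG; split => //.
have i1 : intg P (fun w => Num.sqrt n%:R * S n w) by exact: intgZ.
apply: (@le_trans _ _ (mean P (fun w => Num.sqrt n%:R * S n w))).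
  by apply: mean_le => // w; exact: sum_norm_le_l2.
rewrite meanZ//; apply: ler_wpM2l; first exact: sqrtr_ge0.
have i2 : intg P (fun w => 4 * D w + lambda + s * D w + s^-1 * N w).
  apply: intgD; last exact: intgZ.
  apply: intgD; last exact: intgZ.
  by apply: intgD; [exact: intgZ|exact: intg_cst].
apply: (@le_trans _ _ (mean P (fun w => 4 * D w + lambda + s * D w + s^-1 * N w))).
  apply: mean_le => // w; rewrite [s^-1 * _]mulrC.
  exact: (self_bounding lambda0 s0 (S_ge0 n w) (D_ge0 w) (sqrtr_ge0 _) (S_sqr_le w)).
have j1 := intgZ 4 iD; have j2 := intg_cst P lambda; have j3 := intgZ s iD.
have j4 := intgZ s^-1 iN.
rewrite (meanD (intgD (intgD j1 j2) j3) j4) (meanD (intgD j1 j2) j3) (meanD j1 j2).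
by rewrite mean_cst !meanZ// lerD2l mulrC ler_wpM2r// invr_ge0 (ltW s0).
Qed.

End Coordinate.

(** * Smoothness and the deterministic trajectory *)

Lemma coord_le_norm (R : realType) (d : nat) (x : 'rV[R]_d) i : `|x 0 i| <= `|x|.
Proof.
rewrite [leRHS](_ : _ = mx_norm x)// mx_normrE.
exact: (le_bigmax _ (fun ij => `|x ij.1 ij.2|) (0, i)).
Qed.

Section Smoothness.
Variables (R : realType) (d : nat) (f : 'rV[R]_d -> R) (L : 'rV[R]_d).
Hypothesis L0 : forall i, 0 < L 0 i.
Hypothesis smooth : forall y z : 'rV[R]_d,
  `|f y - f z - dotv (gradient f z) (y - z)| <= 2^-1 * wnorm2 L (y - z).

Lemma dotvBr (x y z : 'rV[R]_d) : dotv x (y - z) = dotv x y - dotv x z.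
Proof.
by rewrite /dotv -sumrB; apply: eq_bigr => i _; rewrite !mxE mulrBr.
Qed.

Lemma wnorm2_parallelogram (x y : 'rV[R]_d) :
  wnorm2 L (2^-1 *: (x + y)) + wnorm2 L (2^-1 *: (x - y)) =
  2^-1 * (wnorm2 L x + wnorm2 L y).
Proof.
rewrite /wnorm2 -!big_split/= mulr_sumr; apply: eq_bigr => i _.
by rewrite !mxE; field.
Qed.

(** A two-sided quadratic bound makes the gradient Lipschitz, without convexity:
    compare [f] at the two points [(x + y + e)/2] and [(x + y - e)/2] with its
    first-order models at [x] and at [y]. *)
Lemma gradient_diff_le (x y e : 'rV[R]_d) :
  dotv (gradient f x) e - dotv (gradient f y) e <=
  2^-1 * (wnorm2 L e + wnorm2 L (x - y)).
Proof.
pose s := x - y.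
pose u := 2^-1 *: (x + y + e); pose u' := 2^-1 *: (x + y - e).
have h1 : u - x = 2^-1 *: (e - s).
  by apply/rowP => i; rewrite !mxE; field.
have h2 : u - y = 2^-1 *: (e + s).
  by apply/rowP => i; rewrite !mxE; field.
have h3 : u' - x = 2^-1 *: (- e - s).
  by apply/rowP => i; rewrite !mxE; field.
have h4 : u' - y = 2^-1 *: (- e + s).
  by apply/rowP => i; rewrite !mxE; field.
have eh : u - x - (u' - x) = e by rewrite h1 h3; apply/rowP => i; rewrite !mxE; field.
have ek : u - y - (u' - y) = e by rewrite h2 h4; apply/rowP => i; rewrite !mxE; field.
have d1 := dotvBr (gradient f x) (u - x) (u' - x).
have d2 := dotvBr (gradient f y) (u - y) (u' - y).
rewrite eh in d1; rewrite ek in d2.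
have := smooth u x; have := smooth u y; have := smooth u' x; have := smooth u' y.
rewrite !ler_norml => /andP[a1 _] /andP[_ a2] /andP[_ a3] /andP[a4 _].
have p1 := wnorm2_parallelogram e s; have p2 := wnorm2_parallelogram (- e) s.
have wN : wnorm2 L (- e) = wnorm2 L e.
  by apply: eq_bigr => i _; rewrite mxE sqrrN.
rewrite -h1 -h2 in p1; rewrite -h3 -h4 wN in p2.
rewrite d1 d2 -/s; lra.
Qed.

Lemma gradient_lipschitz (x y : 'rV[R]_d) i :
  `|gradient f x 0 i - gradient f y 0 i| <=
  Num.sqrt (L 0 i) * Num.sqrt (wnorm2 L (x - y)).
Proof.
set D := gradient f x 0 i - _; pose c := D / L 0 i.
have L0i := L0 i.
have := gradient_diff_le x y (c *: delta_mx 0 i).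
have dE z : dotv (gradient f z) (c *: delta_mx 0 i) = gradient f z 0 i * c.
  rewrite /dotv (bigD1 i)//= big1 => [|j /negbTE ji].
    by rewrite addr0 !mxE !eqxx mulr1.
  by rewrite !mxE eqxx/= ji mulr0 mulr0.
have -> : wnorm2 L (c *: delta_mx 0 i) = L 0 i * c ^+ 2.
  rewrite /wnorm2 (bigD1 i)//= big1 => [|j /negbTE ji].
    by rewrite addr0 !mxE !eqxx mulr1.
  by rewrite !mxE eqxx/= ji mulr0 expr0n mulr0.
rewrite !dE -mulrBl -/D => H.
have W0 : 0 <= wnorm2 L (x - y).
  by apply: sumr_ge0 => j _; rewrite mulr_ge0 ?sqr_ge0// ltW.
rewrite -(sqrtrM _ (ltW L0i)) -sqrtr_sqr ler_wsqrtr//.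
have Dc : D * c = D ^+ 2 / L 0 i by rewrite /c expr2 mulrA.
have Lc : L 0 i * c ^+ 2 = D ^+ 2 / L 0 i by rewrite /c; field; rewrite gt_eqF.
have : D ^+ 2 / L 0 i <= wnorm2 L (x - y) by rewrite Dc Lc in H; lra.
by rewrite ler_pdivrMr// mulrC.
Qed.

Variables (gamma lambda : R) (x1 : 'rV[R]_d) (g v x : nat -> 'rV[R]_d).
Hypotheses (gamma0 : 0 < gamma) (lambda0 : 0 < lambda).
Hypothesis ada : is_adagrad gamma lambda x1 g v x.

Lemma adagrad_v t i : v t 0 i = \sum_(1 <= s < t.+1) g s 0 i ^+ 2.
Proof.
have [v0 _ step] := ada; elim: t => [|t IH]; first by rewrite big_geq// v0 mxE.
by rewrite big_nat_recr//= -IH; have [-> _] := step t.+1 i isT.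
Qed.

Let b t i := lambda + Num.sqrt (\sum_(1 <= s < t.+1) g s 0 i ^+ 2).

Lemma adagrad_x t i : (1 <= t)%N -> x t.+1 0 i - x t 0 i = - (gamma * (g t 0 i / b t i)).
Proof.
move=> t1; have [_ _ step] := ada; have [_ ->] := step t i t1.
by rewrite adagrad_v -/(b t i); ring.
Qed.

Let b_gt0 t i : 0 < b t i. Proof. by rewrite ltr_wpDr ?sqrtr_ge0. Qed.

Lemma adagrad_step_le t i : (1 <= t)%N -> `|x t.+1 0 i - x t 0 i| <= gamma.
Proof.
move=> t1; rewrite adagrad_x// normrN normrM (gtr0_norm gamma0) ler_piMr ?(ltW gamma0)//.
rewrite normrM normfV (gtr0_norm (b_gt0 t i)) ler_pdivrMr// mul1r.
rewrite -sqrtr_sqr; apply: (@le_trans _ _ (Num.sqrt (\sum_(1 <= s < t.+1) g s 0 i ^+ 2))).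
  rewrite ler_wsqrtr//; case: t t1 => // t _; rewrite big_nat_recr//= lerDr.
  by apply: sumr_ge0 => s _; exact: sqr_ge0.
by rewrite lerDr ltW.
Qed.

Lemma adagrad_dist_le t i : `|x t.+1 0 i - x1 0 i| <= gamma * t%:R.
Proof.
have [_ x11 _] := ada; elim: t => [|t IH]; first by rewrite x11 subrr normr0 mulr0.
have -> : x t.+2 0 i - x1 0 i = (x t.+2 0 i - x t.+1 0 i) + (x t.+1 0 i - x1 0 i) by ring.
apply: (le_trans (ler_normD _ _)); rewrite -natr1 mulrDr mulr1 addrC lerD//.
exact: adagrad_step_le.
Qed.

Lemma l1normE : l1norm L = \sum_(i < d) L 0 i.
Proof. by apply: eq_bigr => i _; rewrite gtr0_norm. Qed.

Lemma l1norm_ge0 : 0 <= l1norm L. Proof. exact: sumr_ge0. Qed.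

(** Every coordinate moves by at most [gamma] per step, so the gradients grow at
    most linearly in time: a bound that does not depend on the noise. *)
Lemma adagrad_gradient_le t T i : (1 <= t <= T)%N ->
  `|gradient f (x t) 0 i| <=
  `|gradient f x1| + gamma * Num.sqrt (l1norm L * `|L|) * T%:R.
Proof.
case: t => // t /= tT.
have -> : gradient f (x t.+1) 0 i =
  gradient f x1 0 i + (gradient f (x t.+1) 0 i - gradient f x1 0 i) by ring.
apply: (le_trans (ler_normD _ _)); apply: lerD; first exact: coord_le_norm.
apply: (le_trans (gradient_lipschitz _ _ _)).
have W : wnorm2 L (x t.+1 - x1) <= (gamma * T%:R) ^+ 2 * l1norm L.
  rewrite l1normE mulr_sumr; apply: ler_sum => j _; rewrite mulrC.
  apply: ler_wpM2r; first exact: ltW.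
  rewrite !mxE -(real_normK (num_real _)) lerXn2r ?nnegrE ?mulr_ge0 ?(ltW gamma0)//.
  apply: (le_trans (adagrad_dist_le t j)); apply: ler_wpM2l; first exact: ltW.
  by rewrite ler_nat ltnW.
have gT : 0 <= gamma * T%:R by rewrite mulr_ge0// ltW.
apply: (@le_trans _ _ (Num.sqrt `|L| * Num.sqrt ((gamma * T%:R) ^+ 2 * l1norm L))).
  apply: ler_pM; rewrite ?sqrtr_ge0 ?ler_wsqrtr//.
  by apply: le_trans (ler_norm _) (coord_le_norm _ _).
rewrite sqrtrM ?sqr_ge0// sqrtr_sqr (ger0_norm gT) (sqrtrM _ l1norm_ge0).
by rewrite le_eqVlt; apply/orP; left; apply/eqP; ring.
Qed.

Lemma adagrad_sum_gradient_le T i :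
  \sum_(1 <= t < T.+1) gradient f (x t) 0 i ^+ 2 <=
  (Num.sqrt T%:R *
   (`|gradient f x1| + gamma * Num.sqrt (l1norm L * `|L|) * T%:R)) ^+ 2.
Proof.
set M := _ + _.
have M0 : 0 <= M by rewrite addr_ge0// !mulr_ge0 ?sqrtr_ge0// ltW.
rewrite exprMn sqr_sqrtr// mulr_natl -[X in _ *+ X](subn1 T.+1) -sumr_const_nat.
rewrite !big_nat; apply: ler_sum => t tT.
rewrite -(real_normK (num_real _)) lerXn2r ?nnegrE//.
exact: adagrad_gradient_le.
Qed.

Lemma adagrad_descent T : has_lbound (range f) ->
  gamma * \sum_(i < d) \sum_(1 <= t < T.+1) gradient f (x t) 0 i * g t 0 i / b t i <=
  f x1 - inf (range f) +
  2^-1 * gamma ^+ 2 * \sum_(i < d) L 0 i * \sum_(1 <= t < T.+1) (`|g t 0 i| / b t i) ^+ 2.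
Proof.
move=> lb; have fx : inf (range f) <= f (x T.+1) by apply: ge_inf => //; exists (x T.+1).
apply: (@le_trans _ _ (f x1 - f (x T.+1) + 2^-1 * gamma ^+ 2 *
    \sum_(i < d) L 0 i * \sum_(1 <= t < T.+1) (`|g t 0 i| / b t i) ^+ 2)); last first.
  by rewrite lerD2r lerD2l lerN2.
elim: T {fx} => [|T IH].
  have [_ -> _] := ada; rewrite subrr add0r !big1 ?mulr0// => i _; by rewrite big_geq ?mulr0.
have E1 : \sum_(i < d) \sum_(1 <= t < T.+2) gradient f (x t) 0 i * g t 0 i / b t i =
  \sum_(i < d) \sum_(1 <= t < T.+1) gradient f (x t) 0 i * g t 0 i / b t i +
  \sum_(i < d) gradient f (x T.+1) 0 i * g T.+1 0 i / b T.+1 i.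
  by rewrite -big_split; apply: eq_bigr => i _; rewrite big_nat_recr.
have E2 : \sum_(i < d) L 0 i * \sum_(1 <= t < T.+2) (`|g t 0 i| / b t i) ^+ 2 =
  \sum_(i < d) L 0 i * \sum_(1 <= t < T.+1) (`|g t 0 i| / b t i) ^+ 2 +
  \sum_(i < d) L 0 i * (`|g T.+1 0 i| / b T.+1 i) ^+ 2.
  by rewrite -big_split; apply: eq_bigr => i _; rewrite big_nat_recr//= mulrDr.
rewrite E1 E2.
have := smooth (x T.+2) (x T.+1); rewrite ler_norml => /andP[_].
have -> : dotv (gradient f (x T.+1)) (x T.+2 - x T.+1) =
  - (gamma * \sum_(i < d) gradient f (x T.+1) 0 i * g T.+1 0 i / b T.+1 i).
  rewrite mulr_sumr -sumrN; apply: eq_bigr => i _.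
  have := adagrad_x i (isT : (1 <= T.+1)%N); rewrite !mxE => ->; ring.
have -> : wnorm2 L (x T.+2 - x T.+1) =
  gamma ^+ 2 * \sum_(i < d) L 0 i * (`|g T.+1 0 i| / b T.+1 i) ^+ 2.
  rewrite mulr_sumr; apply: eq_bigr => i _.
  have := adagrad_x i (isT : (1 <= T.+1)%N); rewrite !mxE => ->.
  by rewrite sqrrN exprMn [X in _ = _ * (_ * X)]expr_div_n real_normK ?num_real// expr_div_n; ring.
move: IH; lra.
Qed.

End Smoothness.

(** * Conclusion *)

(** Bookkeeping of exponents: the optimised bound is a combination of the four
    terms of the rate. *)
Lemma rate_bound (R : realType) (p n a B C s Q : R) :
    1 < p <= 2 -> 0 < n -> 0 <= a -> 0 <= B -> 0 <= C -> 0 <= s ->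
  Q = 4 * B + 160 * (s * (C * n `^ (p^-1 - 2^-1))) ->
  Num.sqrt n / n * (4 * Q + a + 2 * Num.sqrt (Q * (s * n `^ p^-1))) <=
  640 * ((a + B) / Num.sqrt n + C * s / n `^ ((p - 1) / p)
         + Num.sqrt (B * s) / n `^ ((p - 1) / (2 * p))
         + Num.sqrt C * s / n `^ ((3 * p - 4) / (4 * p))).
Proof.
move=> /andP[p1 _] n0 a0 B0 C0 s0 QE.
have pn : p != 0 by rewrite gt_eqF//; lra.
have PD x y : n `^ x * n `^ y = n `^ (x + y).
  by rewrite powRD// (gt_eqF n0) implybT.
have PS x : Num.sqrt (n `^ x) = n `^ (x / 2).
  by rewrite -powR12_sqrt ?powR_ge0// -powRrM.
have P0 x : 0 <= n `^ x by exact: powR_ge0.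
have nE : Num.sqrt n = n `^ 2^-1 by rewrite powR12_sqrt// ltW.
have nV : Num.sqrt n / n = n `^ (- 2^-1).
  rewrite nE -{2}(powRr1 (ltW n0)) -powRN PD; congr (_ `^ _); lra.
rewrite nV nE -!powRN.
set W := s * _; set X := C * _ in QE.
have W0 : 0 <= W by rewrite mulr_ge0.
have X0 : 0 <= X by rewrite mulr_ge0.
have sQ : Num.sqrt (Q * W) <= 2 * Num.sqrt (B * W) + 13 * Num.sqrt (s * X * W).
  have -> : Q * W = 2 ^+ 2 * (B * W) + 160 * (s * X * W) by rewrite QE; ring.
  apply: le_trans (sqrtrD_le _ _) _; rewrite ?mulr_ge0//.
  rewrite sqrtrM ?sqr_ge0// sqrtr_sqr ger0_norm// lerD2l sqrtrM//.
  rewrite ler_wpM2r ?sqrtr_ge0// -[leRHS]ger0_norm// -sqrtr_sqr ler_wsqrtr//.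
  by lra.
have e1 : n `^ (- 2^-1) * X = C * n `^ (- ((p - 1) / p)).
  rewrite /X mulrCA PD; congr (_ * _ `^ _); field.
  exact: pn.
have e2 : n `^ (- 2^-1) * Num.sqrt (B * W) =
    Num.sqrt (B * s) * n `^ (- ((p - 1) / (2 * p))).
  rewrite /W mulrA sqrtrM ?mulr_ge0// PS mulrCA PD; congr (_ * _ `^ _); field.
  exact: pn.
have e3 : n `^ (- 2^-1) * Num.sqrt (s * X * W) =
    Num.sqrt C * s * n `^ (- ((3 * p - 4) / (4 * p))).
  have -> : s * X * W = s ^+ 2 * (C * (n `^ (p^-1 - 2^-1) * n `^ p^-1)).
    by rewrite /X /W; ring.
  rewrite PD sqrtrM ?sqr_ge0// sqrtr_sqr ger0_norm// sqrtrM// PS.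
  rewrite [RHS]mulrAC [RHS]mulrC mulrCA; congr (_ * _).
  rewrite mulrCA PD; congr (_ * _ `^ _); field.
  exact: pn.
have h := ler_wpM2l (P0 (- 2^-1)) sQ.
have t1 : 0 <= n `^ (- 2^-1) * B by rewrite mulr_ge0.
have t2 : 0 <= n `^ (- 2^-1) * a by rewrite mulr_ge0.
have t3 : 0 <= n `^ (- 2^-1) * X * s by rewrite !mulr_ge0.
have t4 : 0 <= n `^ (- 2^-1) * Num.sqrt (B * W) by rewrite mulr_ge0 ?sqrtr_ge0.
have t5 : 0 <= n `^ (- 2^-1) * Num.sqrt (s * X * W) by rewrite mulr_ge0 ?sqrtr_ge0.
rewrite -e2 -e3 [C * s * _]mulrAC -e1.
move: h t1 t2 t3 t4 t5; rewrite {2}QE; lra.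
Qed.

Lemma expectation_mean d (T : measurableType d) (R : realType)
    (P : probability T R) (X : T -> R) :
  intg P X -> ('E_P[X] = (mean P X)%:E)%E.
Proof.
by move=> iX; rewrite unlock /mean /Rintegral fineK// integrable_fin_num.
Qed.

Section NaturalFiltration.
Context d (T : measurableType d) (R : realType) (P : probability T R).
Variables (dim : nat) (g : nat -> 'I_dim -> {RV P >-> R}).

(** A generating family of the natural filtration. *)
Definition past (t : nat) : set (set T) :=
  \bigcup_(s in [set s | (1 <= s <= t)%N]) \bigcup_i
    preimage_set_system setT (g s i) measurable.

Lemma past_measurable t : <<s past t>> `<=` measurable.
Proof.
apply: smallest_sub; first exact: sigma_algebra_measurable.
by move=> A [s _] [i _] [B mB <-]; exact: measurable_funPT.
Qed.

Lemma past_mono s t : (s <= t)%N -> past s `<=` past t.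
Proof.
move=> st A [r /= /andP[r1 rs] H]; exists r => //=.
by rewrite r1 (leq_trans rs).
Qed.

Lemma past_adapted s t i : (1 <= s <= t)%N -> adapted (past t) (g s i).
Proof.
move=> st _ B mB; apply: sub_sigma_algebra; exists s => //; exists i => //.
by exists B.
Qed.

End NaturalFiltration.

Unset Implicit Arguments.

Theorem theorem3p1 (R : realType) :
  exists2 c : R, 0 < c &
  forall (d : nat) (disp : measure_display) (Omega : measurableType disp)
    (P : probability Omega R)
    (f : 'rV[R]_d -> R) (L sigma : 'rV[R]_d) (p gamma lambda : R)
    (x1 : 'rV[R]_d) (g : nat -> 'I_d -> {RV P >-> R})
    (v x : nat -> Omega -> 'rV[R]_d) (T : nat),
  (0 < d)%N ->
  (forall y : 'rV[R]_d, differentiable f y) ->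
  has_lbound (range f) ->
  (forall i, 0 < L 0 i) ->
  (forall y z : 'rV[R]_d,
     `|f y - f z - dotv (gradient f z) (y - z)| <= 2^-1 * wnorm2 L (y - z)) ->
  0 < gamma ->
  0 < lambda ->
  (forall w, is_adagrad gamma lambda x1
     (fun t => \row_(i < d) g t i w) (v ^~ w) (x ^~ w)) ->
  1 < p <= 2 ->
  (forall i, 0 <= sigma 0 i) ->
  (forall t (i : 'I_d), (1 <= t)%N ->
     is_cond_expectation P (natural_filtration g t.-1)
       (g t i) (fun w => gradient f (x t w) 0 i)) ->
  (forall t (i : 'I_d), (1 <= t)%N ->
     cond_expectation_le P (natural_filtration g t.-1)
       (fun w => `|g t i w - gradient f (x t w) 0 i| `^ p)
       (sigma 0 i `^ p)) ->
  (0 < T)%N ->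
  let fstar := inf (range f) in
  let Delta := f x1 - fstar in
  let pbar := p / (p - 1) in
  let K : R := 1 + (Num.sqrt 2 * `|sigma| * T%:R `^ (1 / p)
                + 2 * `|gradient f x1| * T%:R `^ (1 / 2)
                + 2 * gamma * Num.sqrt (l1norm L * `|L|) * T%:R `^ (3 / 2))
               / lambda in
  let A := d%:R * lambda + Delta / gamma + gamma * l1norm L * ln K in
  let B := Delta / gamma + gamma * l1norm L * ln K in
  let C := ln K `^ (1 / pbar + 1 / 2) in
  ('E_P[fun w => (T%:R^-1 * \sum_(1 <= t < T.+1) l1norm (gradient f (x t w)))%R]
   <= (c * (A / Num.sqrt T%:R
            + C * l1norm sigma / T%:R `^ ((p - 1) / p)
            + Num.sqrt (B * l1norm sigma) / T%:R `^ ((p - 1) / (2 * p))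
            + Num.sqrt C * l1norm sigma
                / T%:R `^ ((3 * p - 4) / (4 * p))))%R%:E)%E.
Proof.
exists 640; first by rewrite ltr0n.
move=> d disp Omega P f L sigma p gamma lambda x1 g v x T d0 _ fb L0 smooth gamma0
  lambda0 ada p12 sigma0 cG moment T0.
cbv zeta; set Delta := f x1 - inf (range f).
set K : R := 1 + _ / lambda.
set B : R := Delta / gamma + gamma * l1norm L * ln K.
set A : R := d%:R * lambda + Delta / gamma + gamma * l1norm L * ln K.
set C : R := ln K `^ _.
have TR : 0 < T%:R :> R by rewrite ltr0n.
have Tn : T%:R != 0 :> R by rewrite gt_eqF.
have p1 : 1 < p by case/andP: p12.
pose G i t w := gradient f (x t w) 0 i.
pose rL := Num.sqrt (l1norm L * `|L|).
pose M := Num.sqrt T%:R * (`|gradient f x1| + gamma * rL * T%:R).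
have M0 : 0 <= M.
  by rewrite mulr_ge0 ?sqrtr_ge0// addr_ge0// !mulr_ge0 ?sqrtr_ge0// ltW.
have GM i w : \sum_(1 <= s < T.+1) G i s w ^+ 2 <= M ^+ 2.
  exact: (adagrad_sum_gradient_le L0 smooth gamma0 lambda0 (ada w)).
have KE : lambda * K = lambda + 2 * M + Num.sqrt 2 * `|sigma| * T%:R `^ p^-1.
  have T12 : Num.sqrt T%:R = T%:R `^ 2^-1 :> R by rewrite powR12_sqrt// ltW.
  have T32 : T%:R `^ (3 / 2) = Num.sqrt T%:R * T%:R :> R.
    rewrite T12 -{3}(powRr1 (ltW TR)) -powRD ?(negbTE Tn) ?implybT//.
    by congr (_ `^ _); field.
  rewrite /K !mul1r T32 T12 /M -/rL T12; field.
  by rewrite gt_eqF.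
have K1 : 1 < K.
  rewrite /K ltrDl divr_gt0// -addrA ltr_wpDl ?mulr_ge0 ?sqrtr_ge0 ?powR_ge0//.
  rewrite ltr_wpDl ?mulr_ge0 ?powR_ge0// !mulr_gt0 ?powR_gt0// sqrtr_gt0.
  have Lp : 0 < L 0 (Ordinal d0) by [].
  rewrite mulr_gt0//.
    rewrite l1normE// (bigD1 (Ordinal d0))//= ltr_wpDr// sumr_ge0// => i _.
    exact: ltW.
  by apply: lt_le_trans Lp (le_trans (ler_norm _) (coord_le_norm _ _)).
have lnK := ln_gt0 K1.
have K_ge i : lambda + 2 * M + Num.sqrt 2 * sigma 0 i * T%:R `^ p^-1 <= lambda * K.
  rewrite KE lerD2l ler_wpM2r ?powR_ge0// ler_wpM2l ?sqrtr_ge0//.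
  exact: le_trans (ler_norm _) (coord_le_norm _ _).
pose b i t w := lambda + Num.sqrt (\sum_(1 <= s < t.+1) g s i w ^+ 2).
pose D i w := \sum_(1 <= t < T.+1) G i t w ^+ 2 / (b i t.-1 w
  + Num.sqrt (\sum_(1 <= s < t.+1) G i s w ^+ 2)).
pose F i t w := G i t w * g t i w / b i t w.
pose psi i t w := `|g t i w| / b i t w.
have ag i s t : (1 <= s <= t)%N -> adapted (past g t) (g s i) by exact: past_adapted.
have mono := @past_mono _ _ _ P _ g; have sC := @past_measurable _ _ _ P _ g.
have cG' i t (t1 : (1 <= t)%N) := cG t i t1.
have mom' i t (t1 : (1 <= t)%N) := moment t i t1.
have psi_sum i := mean_sum_psi_sqr sC mono p12 (sigma0 i) lambda0 T0 (ag i) (cG' i)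
    (mom' i) M0 (GM i) K1 (K_ge i).
have D_le i : mean P (D i) <= 4 * \sum_(1 <= t < T.+1) mean P (F i t) +
    160 * (sigma 0 i * (ln K `^ (1 - p^-1 + 2^-1) * T%:R `^ (p^-1 - 2^-1))).
  exact: (mean_D_le sC mono p12 (sigma0 i) lambda0 T0 (ag i) (cG' i)
    (mom' i) M0 (GM i) K1 (K_ge i)).
have norm_le i s (s_gt0 : 0 < s) :
    intg P (fun w => \sum_(1 <= t < T.+1) `|G i t w|) /\
    mean P (fun w => \sum_(1 <= t < T.+1) `|G i t w|) <=
    Num.sqrt T%:R * (4 * mean P (D i) + lambda + s * mean P (D i) +
      sigma 0 i * T%:R `^ p^-1 / s).
  exact: (mean_sum_norm_G sC mono p12 (sigma0 i) lambda0 T0 (ag i) (cG' i)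
    (mom' i) M0 (GM i) s_gt0).
have iF i t := @intg_progress _ _ _ _ _ sC mono _ _ _ _ _ lambda0 (ag i) (cG' i) M0 (GM i) t.
have ipsi i t (t1 : (1 <= t)%N) := intg_psi_sqr P sC lambda0 (ag i) t1.
have gE t i w : (\row_j g t j w) 0 i = g t i w by rewrite mxE.
have bE i t w : lambda + Num.sqrt (\sum_(1 <= s < t.+1) (\row_j g s j w) 0 i ^+ 2) = b i t w.
  by congr (_ + Num.sqrt _); apply: eq_bigr => s _; rewrite gE.
have descent w : gamma * \sum_(i < d) \sum_(1 <= t < T.+1) F i t w <=
    Delta + 2^-1 * gamma ^+ 2 * \sum_(i < d) L 0 i * \sum_(1 <= t < T.+1) psi i t w ^+ 2.
  have := adagrad_descent smooth (ada w) T fb.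
  congr (_ * _ <= _ + _ * _).
    by apply: eq_bigr => i _; apply: eq_bigr => t _; rewrite bE gE.
  by apply: eq_bigr => i _; congr (_ * _); apply: eq_bigr => t _; rewrite bE gE.
have iFs i : intg P (fun w => \sum_(1 <= t < T.+1) F i t w) /\
    mean P (fun w => \sum_(1 <= t < T.+1) F i t w) = \sum_(1 <= t < T.+1) mean P (F i t).
  by apply: intg_sum_nat => t tT; exact: iF tT.
have ips i : intg P (fun w => \sum_(1 <= t < T.+1) psi i t w ^+ 2) /\
    mean P (fun w => \sum_(1 <= t < T.+1) psi i t w ^+ 2) =
    \sum_(1 <= t < T.+1) mean P (fun w => psi i t w ^+ 2).
  by apply: intg_sum_nat => t /andP[t1 _]; exact: ipsi t1.
have Delta0 : 0 <= Delta by rewrite subr_ge0; apply: ge_inf => //; exists x1.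
have progress : \sum_(i < d) \sum_(1 <= t < T.+1) mean P (F i t) <= B.
  have i1 : intg P (fun w => \sum_(i < d) \sum_(1 <= t < T.+1) F i t w).
    by apply: intg_sum => i _; case: (iFs i).
  have i2 i : intg P (fun w => L 0 i * \sum_(1 <= t < T.+1) psi i t w ^+ 2).
    by apply: intgZ; case: (ips i).
  have i3 : intg P (fun w => \sum_(i < d) L 0 i * \sum_(1 <= t < T.+1) psi i t w ^+ 2).
    by apply: intg_sum => i _; exact: i2.
  have := mean_le (intgZ gamma i1) (intgD (intg_cst P Delta)
    (intgZ (2^-1 * gamma ^+ 2) i3)) descent.
  rewrite (meanD (intg_cst P Delta) (intgZ _ i3)) mean_cst !meanZ//.
  rewrite !mean_sum//; last by move=> i; case: (iFs i).
  under eq_bigr => i _ do rewrite (proj2 (iFs i)).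
  have e2 : \sum_(i < d) mean P (fun w => L 0 i * \sum_(1 <= t < T.+1) psi i t w ^+ 2) <=
      l1norm L * (2 * ln K).
    rewrite l1normE// mulr_suml; apply: ler_sum => i _.
    have [i4 e4] := ips i; rewrite meanZ// e4.
    by apply: ler_wpM2l; [exact: ltW|exact: psi_sum].
  move=> H; have g2 : 0 <= 2^-1 * gamma ^+ 2 by rewrite mulr_ge0 ?sqr_ge0.
  have := le_trans H (lerD (lexx Delta) (ler_wpM2l g2 e2)).
  rewrite mulrC -ler_pdivlMr// => /le_trans; apply; rewrite /B.
  by rewrite le_eqVlt; apply/orP; left; apply/eqP; field; rewrite gt_eqF.
have B0 : 0 < B.
  rewrite /B ltr_wpDl ?divr_ge0 ?(ltW gamma0)// !mulr_gt0//.
  rewrite l1normE// (bigD1 (Ordinal d0))//= ltr_wpDr// sumr_ge0// => i _.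
  exact: ltW.
have CE : C = ln K `^ (1 - p^-1 + 2^-1).
  rewrite /C; congr (_ `^ _); field; rewrite gt_eqF; lra.
have C0 : 0 <= C by rewrite powR_ge0.
have s0 : 0 <= l1norm sigma by apply: sumr_ge0.
have sE : l1norm sigma = \sum_(i < d) sigma 0 i.
  by apply: eq_bigr => i _; rewrite ger0_norm.
pose Q := 4 * B + 160 * (l1norm sigma * (C * T%:R `^ (p^-1 - 2^-1))).
have sumD : \sum_(i < d) mean P (D i) <= Q.
  apply: (@le_trans _ _ (\sum_(i < d) (4 * \sum_(1 <= t < T.+1) mean P (F i t) +
      160 * (sigma 0 i * (ln K `^ (1 - p^-1 + 2^-1) * T%:R `^ (p^-1 - 2^-1)))))).
    by apply: ler_sum => i _; exact: D_le.
  rewrite big_split/= -!mulr_sumr -mulr_suml -sE -CE lerD2r.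
  by rewrite ler_wpM2l.
have Q0 : 0 < Q by rewrite ltr_pwDl ?mulr_gt0// !mulr_ge0 ?powR_ge0.
have sqT : 0 < Num.sqrt T%:R :> R by rewrite sqrtr_gt0.
pose W := l1norm sigma * T%:R `^ p^-1.
have W0 : 0 <= W by rewrite mulr_ge0 ?powR_ge0.
have XE w : T%:R^-1 * \sum_(1 <= t < T.+1) l1norm (gradient f (x t w)) =
    T%:R^-1 * \sum_(i < d) \sum_(1 <= t < T.+1) `|G i t w|.
  by rewrite exchange_big.
have iN i : intg P (fun w => \sum_(1 <= t < T.+1) `|G i t w|).
  by have [] := norm_le i 1 ltr01.
have iX : intg P (fun w => T%:R^-1 * \sum_(1 <= t < T.+1) l1norm (gradient f (x t w))).
  under eq_fun do rewrite XE.
  by apply: intgZ; exact: intg_sum.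
rewrite (expectation_mean iX) lee_fin (eq_mean P XE) meanZ ?mean_sum//; last exact: intg_sum.
(* A common [s] for all coordinates: the noise levels add up to the l^1 norm
   of [sigma]. *)
have key : (\sum_(i < d) mean P (fun w => \sum_(1 <= t < T.+1) `|G i t w|)) / Num.sqrt T%:R <=
    (4 * Q + d%:R * lambda) + 2 * Num.sqrt (Q * W).
  apply: le_two_sqrt => // s s_gt0; rewrite ler_pdivrMr//.
  apply: (@le_trans _ _ (\sum_(i < d) (Num.sqrt T%:R * (4 * mean P (D i) + lambda
      + s * mean P (D i) + sigma 0 i * T%:R `^ p^-1 / s)))).
    by apply: ler_sum => i _; case: (norm_le i s s_gt0).
  rewrite -mulr_sumr mulrC ler_wpM2r ?sqrtr_ge0//.
  rewrite !big_split/= -!mulr_sumr -!mulr_suml -sE -/W sumr_const card_ord -[lambda *+ d]mulr_natl.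
  by have := ler_wpM2l (ltW s_gt0) sumD; move: sumD; lra.
have rate := rate_bound p12 TR (mulr_ge0 (ler0n _ d) (ltW lambda0)) (ltW B0) C0 s0 (erefl Q).
rewrite -/W in rate.
have -> : A = d%:R * lambda + B by rewrite /A /B addrA.
apply: le_trans rate.
rewrite ler_pdivrMr// in key.
have TV0 : 0 <= T%:R^-1 :> R by rewrite invr_ge0 ltW.
have := ler_wpM2l TV0 key.
move=> /le_trans; apply.
by rewrite le_eqVlt; apply/orP; left; apply/eqP; ring.
Qed.
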